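(* Let $A$ be a unital bounded $*$-algebra over $\mathbb{C}$ which is a direct sum of endomorphically simple $*$-algebras $A_n$. Then $A$ is $C^*$-representable if and only if $A$ is completely positive.
   Context: For a unital $*$-algebra $A$ with unit $e$, $A_{sa}$ is the set of self-adjoint elements and $A_+=\{\sum_{i=1}^n a_i^*a_i : n\ge 1,\ a_i\in A\}$. For $a,b\in A_{sa}$ write $a\ge b$ if $a-b\in A_+$. An element $a\in A_{sa}$ is bounded if $\alpha e\ge a\ge-\alpha e$ for some real $\alpha\ge 0$; $x=a+ib$ with $a,b\in A_{sa}$ is bounded if $a$ and $b$ are; $A$ is bounded if all its elements are bounded. An ideal $I$ of a $*$-algebra $B$ is endomorphically closed if $f(I)\subseteq I$ for every $*$-endomorphism $f:B\to B$. $B$ is endomorphically simple if its only endomorphically closed $*$-ideals are the trivial ones, $\{0\}$ and $B$. A $*$-algebra $B$ is positive if $x^*x=0$ with $x\in B$ implies $x=0$. $A$ is completely positive if $M_n(A)$ is positive for every $n\ge1$. $A$ is $C^*$-representable if it is $*$-isomorphic to a $*$-subalgebra of a $C^*$-algebra. *)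

(* Defs.v *)
From HB Require Import structures.
From mathcomp Require Import all_boot all_order all_algebra.
From mathcomp Require Import complex.
From mathcomp Require Import all_classical all_reals all_analysis.

Set Implicit Arguments.
Unset Strict Implicit.
Unset Printing Implicit Defensive.

Import Order.TTheory GRing.Theory Num.Theory.
Import numFieldNormedType.Exports.

Local Open Scope classical_set_scope.
Local Open Scope complex_scope.
Local Open Scope ring_scope.

Reserved Notation "x ** y" (at level 40, left associativity).

(* Complex *-algebras are not required to be unital: ideals, summands and
   C*-algebras need not have a unit, so that [algType] is too restrictive. *)
HB.mixin Record isStarAlgebra (R : realType) A of GRing.Lmodule R[i] A := {
  smul : A -> A -> A;
  star : A -> A;
  smulA : associative smul;
  smulDl : left_distributive smul +%R;
  smulDr : right_distributive smul +%R;
  smulZl : forall (c : R[i]) (x y : A), smul (c *: x) y = c *: smul x y;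
  smulZr : forall (c : R[i]) (x y : A), smul x (c *: y) = c *: smul x y;
  starK : involutive star;
  starD : {morph star : x y / x + y};
  starM : forall x y : A, star (smul x y) = smul (star y) (star x);
  starZ : forall (c : R[i]) (x : A), star (c *: x) = c^* *: star x
}.

#[short(type="starAlgType")]
HB.structure Definition StarAlgebra (R : realType) :=
  { A of isStarAlgebra R A & GRing.Lmodule R[i] A }.

Notation "x ** y" := (smul x y) : ring_scope.

(* The norm of a [normedModType R[i]] takes its values in [R[i]]; it is
   nonnegative for the partial order of [R[i]], hence a real number. *)
HB.mixin Record isCstarAlgebra (R : realType) X
    of StarAlgebra R X & CompleteNormedModule R[i] X := {
  cstar_normM : forall x y : X, `|x ** y| <= `|x| * `|y|;
  cstar_norm : forall x : X, `|star x ** x| = `|x| ^+ 2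
}.

#[short(type="cstarAlgType")]
HB.structure Definition CstarAlgebra (R : realType) :=
  { X of isCstarAlgebra R X & StarAlgebra R X & CompleteNormedModule R[i] X }.

(* M_n(A): the library scales matrices only by elements of the ring of
   their entries, hence the alias, on which R[i] acts entrywise. *)
Definition starmx (R : realType) (A : starAlgType R) (n : nat) : Type := 'M[A]_n.

Section StarMatrix.
Context {R : realType} {A : starAlgType R} {n : nat}.
Implicit Types (x y z : starmx A n) (c d : R[i]).

HB.instance Definition _ := GRing.Zmodule.copy (starmx A n) 'M[A]_n.

Definition starmx_scale c x : starmx A n := \matrix_(i, j) (c *: x i j).
Definition starmx_mul x y : starmx A n :=
  \matrix_(i, j) \sum_k x i k ** y k j.
Definition starmx_star x : starmx A n := \matrix_(i, j) star (x j i).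

Fact starmx_scaleA c d x :
  starmx_scale c (starmx_scale d x) = starmx_scale (c * d) x.
Proof. by apply/matrixP => i j; rewrite !mxE scalerA. Qed.

Fact starmx_scale1 : left_id 1 starmx_scale.
Proof. by move=> x; apply/matrixP => i j; rewrite !mxE scale1r. Qed.

Fact starmx_scaleDr : right_distributive starmx_scale +%R.
Proof. by move=> c x y; apply/matrixP => i j; rewrite !mxE scalerDr. Qed.

Fact starmx_scaleDl x : {morph starmx_scale^~ x : c d / c + d}.
Proof. by move=> c d; apply/matrixP => i j; rewrite !mxE scalerDl. Qed.

HB.instance Definition _ := GRing.Zmodule_isLmodule.Build R[i] (starmx A n)
  starmx_scaleA starmx_scale1 starmx_scaleDr starmx_scaleDl.

Let smul0 (a : A) : a ** 0 = 0.
Proof. by apply: (addrI (a ** 0)); rewrite -smulDr !addr0. Qed.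

Let mul0s (a : A) : 0 ** a = 0.
Proof. by apply: (addrI (0 ** a)); rewrite -smulDl !addr0. Qed.

Let star0 : star (0 : A) = 0.
Proof. by apply: (addrI (star (0 : A))); rewrite -starD !addr0. Qed.

Let sum_smul (I : finType) (f : I -> A) (a : A) :
  (\sum_i f i) ** a = \sum_i f i ** a.
Proof.
by apply: (big_morph (fun b => b ** a)) => [b c|]; rewrite ?smulDl ?mul0s.
Qed.

Let smul_sum (I : finType) (f : I -> A) (a : A) :
  a ** (\sum_i f i) = \sum_i a ** f i.
Proof. by apply: (big_morph (smul a)) => [b c|]; rewrite ?smulDr ?smul0. Qed.

Fact starmx_mulA : associative starmx_mul.
Proof.
move=> x y z; apply/matrixP => i j; rewrite !mxE.
under eq_bigr do rewrite mxE smul_sum.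
rewrite exchange_big; apply: eq_bigr => k _ /=.
by rewrite mxE sum_smul; apply: eq_bigr => l _; rewrite smulA.
Qed.

Fact starmx_mulDl : left_distributive starmx_mul +%R.
Proof.
move=> x y z; apply/matrixP => i j; rewrite !mxE -big_split.
by apply: eq_bigr => k _; rewrite mxE smulDl.
Qed.

Fact starmx_mulDr : right_distributive starmx_mul +%R.
Proof.
move=> x y z; apply/matrixP => i j; rewrite !mxE -big_split.
by apply: eq_bigr => k _; rewrite mxE smulDr.
Qed.

Fact starmx_mulZl c x y : starmx_mul (c *: x) y = c *: starmx_mul x y.
Proof.
apply/matrixP => i j; rewrite !mxE scaler_sumr.
by apply: eq_bigr => k _; rewrite mxE smulZl.
Qed.

Fact starmx_mulZr c x y : starmx_mul x (c *: y) = c *: starmx_mul x y.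
Proof.
apply/matrixP => i j; rewrite !mxE scaler_sumr.
by apply: eq_bigr => k _; rewrite mxE smulZr.
Qed.

Fact starmx_starK : involutive starmx_star.
Proof. by move=> x; apply/matrixP => i j; rewrite !mxE starK. Qed.

Fact starmx_starD : {morph starmx_star : x y / x + y}.
Proof. by move=> x y; apply/matrixP => i j; rewrite !mxE starD. Qed.

Fact starmx_starM x y :
  starmx_star (starmx_mul x y) = starmx_mul (starmx_star y) (starmx_star x).
Proof.
apply/matrixP => i j; rewrite !mxE (big_morph _ (@starD _ A) star0).
by apply: eq_bigr => k _; rewrite !mxE starM.
Qed.

Fact starmx_starZ c x : starmx_star (c *: x) = c^* *: starmx_star x.
Proof. by apply/matrixP => i j; rewrite !mxE starZ. Qed.

HB.instance Definition _ := isStarAlgebra.Build R (starmx A n)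
  starmx_mulA starmx_mulDl starmx_mulDr starmx_mulZl starmx_mulZr
  starmx_starK starmx_starD starmx_starM starmx_starZ.

End StarMatrix.

Section StarAlgebraNotions.
Context {R : realType}.
Implicit Types A B : starAlgType R.

Definition is_identity A (e : A) : Prop := forall a, e ** a = a /\ a ** e = a.

Definition self_adjoint A (a : A) : Prop := star a = a.

Definition pos_cone A : set A :=
  [set x | exists n (a : 'I_n.+1 -> A), x = \sum_i star (a i) ** a i].

Definition sa_bounded A (e a : A) : Prop :=
  exists2 alpha : R, 0 <= alpha &
    pos_cone (alpha%:C *: e - a) /\ pos_cone (a - (- alpha%:C) *: e).

Definition elt_bounded A (e x : A) : Prop :=
  exists a b : A, [/\ self_adjoint a, self_adjoint b, x = a + 'i *: b,
    sa_bounded e a & sa_bounded e b].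

Definition bounded_alg A (e : A) : Prop := forall x : A, elt_bounded e x.

(* *-homomorphisms are not required to preserve units. *)
Definition star_hom A B (f : A -> B) : Prop :=
  [/\ linear f, {morph f : x y / x ** y} & {morph f : x / star x}].

Definition star_subspace A (S : set A) : Prop :=
  [/\ S 0, forall x y, S x -> S y -> S (x + y),
      forall (c : R[i]) x, S x -> S (c *: x) & forall x, S x -> S (star x)].

Definition star_subalgebra A (S : set A) : Prop :=
  star_subspace S /\ forall x y, S x -> S y -> S (x ** y).

Definition star_ideal A (I : set A) : Prop :=
  star_subspace I /\ forall a x, I x -> I (a ** x) /\ I (x ** a).

Definition endo_closed A (I : set A) : Prop :=
  forall f : A -> A, star_hom f -> f @` I `<=` I.

Definition endo_simple A : Prop :=
  forall I : set A, star_ideal I -> endo_closed I -> I = [set 0] \/ I = setT.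

Definition positive_alg A : Prop := forall x : A, star x ** x = 0 -> x = 0.

Definition completely_positive A : Prop :=
  forall n, (0 < n)%N -> positive_alg (starmx A n).

Definition Cstar_representable A : Prop :=
  exists (X : cstarAlgType R) (S : set X) (f : A -> X),
    [/\ star_subalgebra S, star_hom f, injective f & range f = S].

(* The map [a |-> (p n a)_n] is a *-isomorphism of A onto the finitely
   supported families in the product of the B n, with pointwise operations. *)
Definition is_direct_sum A (I : Type) (B : I -> starAlgType R) : Prop :=
  exists p : forall n, A -> B n,
    [/\ forall n, star_hom (p n),
        forall a a', (forall n, p n a = p n a') -> a = a',
        forall a, finite_set [set n | p n a != 0] &
        forall b : (forall n, B n), finite_set [set n | b n != 0] ->
          exists a, forall n, p n a = b n].

End StarAlgebraNotions.

Arguments endo_simple {R} A.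
Arguments positive_alg {R} A.
Arguments completely_positive {R} A.
Arguments Cstar_representable {R} A.
Arguments is_direct_sum {R} A {I} B.

(* Main.v *)
Require Import Defs.
From HB Require Import structures.
From mathcomp Require Import all_boot all_order all_algebra.
From mathcomp Require Import generic_quotient ring_quotient complex ring lra.
From mathcomp Require Import all_classical all_reals all_analysis.

(** Both directions reduce to sums of squares.  Testing complete positivity on
    matrices with constant rows shows that it says exactly that
    [\sum_i star (a i) ** a i = 0] forces every [a i] to vanish
    ([completely_positiveP]).

    If [A] embeds in a C*-algebra, pull the norm back to [A] and complete: [A]
    then embeds in a C*-algebra whose unit is that of [A], and the sum-of-squares
    property is the theorem of Kelley and Vaught that elements [a^* a] are
    positive.  No functional calculus is used.  A self-adjoint [h] is called
    positive when [N (t e - h) <= t] for some [t > 0]; these elements obviously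
    form a convex cone.  Four facts about this cone suffice.
    - It is pointed, because [e] is an extreme point of the unit ball among
      self-adjoint elements ([csn_extreme]).
    - Squares of self-adjoint elements are positive ([cstar_sqr_pos]); this uses
      square roots [s^2 = e - g] for [N g <= 1], obtained by iterating
      [y |-> (g + y^2) / 2] ([cstar_sqrt]), the only appeal to completeness.
    - If [- c^* c] is positive, so is [- c c^*] ([csn_flip]), whence
      [2 c^* c], the sum of two self-adjoint squares and of [- 2 c c^*], is
      positive as well, and [c = 0] by pointedness ([cstar_neg_star_sqr]).
    - Applied to [c = a (m - h)], where [h = a^* a] and [m] is the square root
      of [h^2], this gives [h = m], so [h] is positive ([cstar_star_sqr_pos]).

    Conversely, in a bounded unital star algebra the numbers [t] such that
    [t^2 e >= a^* a] have an infimum [order_norm a], and the order alone makes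
    this a C*-seminorm ([order_seminorm]).  Its kernel is a star ideal stable
    under all endomorphisms, since a star homomorphism sends the unit to a
    projection and thus cannot increase the seminorm.  In an endomorphically
    simple summand with unit [u] the kernel is therefore zero or everything; in
    the latter case [u / 4 >= u], so [- u] is a sum of squares, which complete
    positivity allows only when the summand is zero.  Projecting to the summands,
    the seminorm of [A] is a norm, and [A] embeds in its completion.

    The completion with respect to a C*-seminorm is built as the algebra of
    bounded sequences with the seminorm [limsup], divided by its kernel: this
    quotient is complete whatever the algebra one starts from, and contains it
    as the constant sequences. *)

Set Implicit Arguments.
Unset Strict Implicit.
Unset Printing Implicit Defensive.

Import Order.TTheory GRing.Theory Num.Theory.
Import numFieldNormedType.Exports.
Import ComplexField.Normc.

Local Open Scope classical_set_scope.
Local Open Scope complex_scope.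
Local Open Scope quotient_scope.
Local Open Scope ring_scope.

(** * Linear identities by ring arithmetic *)

Section TrivialExtension.
Context {K : comNzRingType} {V : lmodType K}.

(** The square-zero extension of [K] by [V]: a commutative ring that contains
    [V], with scaling as multiplication, so that an identity between linear
    combinations in [V] becomes one that [ring] decides. *)
Definition trivext : Type := (K * V)%type.
HB.instance Definition _ := GRing.Zmodule.on trivext.
Implicit Types x y z : trivext.

Definition trivext_mul x y : trivext := (x.1 * y.1, x.1 *: y.2 + y.1 *: x.2).

Fact trivext_mulA : associative trivext_mul.
Proof.
move=> x y z; rewrite /trivext_mul /= mulrA; congr pair.
rewrite !scalerDr !scalerA addrA.
by rewrite -(mulrC z.1 x.1) -(mulrC z.1 y.1) (mulrC x.1).
Qed.

Fact trivext_mulC : commutative trivext_mul.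
Proof. by move=> x y; rewrite /trivext_mul mulrC addrC. Qed.

Fact trivext_mul1 : left_id ((1, 0) : trivext) trivext_mul.
Proof.
by case=> a u; rewrite /trivext_mul /= mul1r scale1r scaler0 addr0.
Qed.

Fact trivext_mulDl : left_distributive trivext_mul +%R.
Proof.
move=> x y z; rewrite /trivext_mul /= mulrDl scalerDl scalerDr.
by congr pair; rewrite addrACA.
Qed.

Fact trivext_oner_neq0 : ((1, 0) : trivext) != 0.
Proof. by rewrite xpair_eqE oner_eq0. Qed.

HB.instance Definition _ := GRing.Zmodule_isComNzRing.Build trivext
  trivext_mulA trivext_mulC trivext_mul1 trivext_mulDl trivext_oner_neq0.

Definition trivext_scalar (c : K) : trivext := (c, 0).
Definition trivext_vector (v : V) : trivext := (0, v).

Fact trivext_scalar_additive : zmod_morphism trivext_scalar.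
Proof. by move=> a b; congr pair; rewrite /= subr0. Qed.

Fact trivext_scalar_multiplicative : monoid_morphism trivext_scalar.
Proof.
by split=> // a b; congr pair; rewrite /= !scaler0 addr0.
Qed.

HB.instance Definition _ := GRing.isZmodMorphism.Build K trivext trivext_scalar
  trivext_scalar_additive.
HB.instance Definition _ := GRing.isMonoidMorphism.Build K trivext trivext_scalar
  trivext_scalar_multiplicative.

Fact trivext_vector_additive : zmod_morphism trivext_vector.
Proof. by move=> u v; congr pair; rewrite /= subr0. Qed.

HB.instance Definition _ := GRing.isZmodMorphism.Build V trivext trivext_vector
  trivext_vector_additive.

Lemma trivext_vectorZ (c : K) v :
  trivext_vector (c *: v) = trivext_scalar c * trivext_vector v.
Proof. by congr pair; rewrite /= ?mulr0 ?scaler0 ?addr0. Qed.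

Lemma trivext_vectorD u v :
  trivext_vector (u + v) = trivext_vector u + trivext_vector v.
Proof. exact: raddfD. Qed.

Lemma trivext_vectorN v : trivext_vector (- v) = - trivext_vector v.
Proof. exact: raddfN. Qed.

Lemma trivext_vector_inj : injective trivext_vector.
Proof. by move=> u v []. Qed.

Definition trivextE := (trivext_vectorD, trivext_vectorN, trivext_vectorZ).

End TrivialExtension.
Arguments trivext : clear implicits.

Ltac lmod_eq := apply: trivext_vector_inj; rewrite ?trivextE; ring.


(** * Star algebras *)

Section StarAlgebraTheory.
Context {R : realType} {A : starAlgType R}.
Implicit Types (a b c x y : A) (z : R[i]).

Lemma smulr0 a : a ** 0 = 0.
Proof. by apply: (addrI (a ** 0)); rewrite -smulDr !addr0. Qed.

Lemma smul0r a : 0 ** a = 0.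
Proof. by apply: (addrI (0 ** a)); rewrite -smulDl !addr0. Qed.

Lemma smulrN a b : a ** (- b) = - (a ** b).
Proof. by apply/eqP; rewrite -subr_eq0 opprK -smulDr addNr smulr0. Qed.

Lemma smulNr a b : (- a) ** b = - (a ** b).
Proof. by apply/eqP; rewrite -subr_eq0 opprK -smulDl addNr smul0r. Qed.

Lemma smulrBr a b c : a ** (b - c) = a ** b - a ** c.
Proof. by rewrite smulDr smulrN. Qed.

Lemma smulrBl a b c : (b - c) ** a = b ** a - c ** a.
Proof. by rewrite smulDl smulNr. Qed.

Lemma star0 : star (0 : A) = 0.
Proof. by apply: (addrI (star (0 : A))); rewrite -starD !addr0. Qed.

Lemma starN a : star (- a) = - star a.
Proof. by apply/eqP; rewrite -subr_eq0 opprK -starD addNr star0. Qed.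

Lemma starB a b : star (a - b) = star a - star b.
Proof. by rewrite starD starN. Qed.

Lemma conjRC (r : R) : (r%:C)^* = r%:C :> R[i].
Proof. by apply/eqP; rewrite eq_complex /= ?oppr0 !eqxx. Qed.

Lemma starZR (r : R) a : star (r%:C *: a) = r%:C *: star a.
Proof. by rewrite starZ conjRC. Qed.

Lemma smul_suml (I : finType) (f : I -> A) a :
  (\sum_i f i) ** a = \sum_i f i ** a.
Proof.
by apply: (big_morph (fun b => b ** a)) => [b c|]; rewrite ?smulDl ?smul0r.
Qed.

Lemma smul_sumr (I : finType) (f : I -> A) a :
  a ** (\sum_i f i) = \sum_i a ** f i.
Proof. by apply: (big_morph (smul a)) => [b c|]; rewrite ?smulDr ?smulr0. Qed.

End StarAlgebraTheory.

Lemma normcC (R : realType) (r : R) : normc r%:C = `|r|.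
Proof. by rewrite /= expr0n addr0 sqrtr_sqr. Qed.

Lemma normc_ge0 (R : realType) (z : R[i]) : 0 <= normc z.
Proof. by case: z => a b; rewrite sqrtr_ge0. Qed.

Lemma normc_gt0 (R : realType) (z : R[i]) : z != 0 -> 0 < normc z.
Proof.
move=> z0; rewrite lt_def normc_ge0 andbT.
by apply: contra z0 => /eqP/eq0_normc/eqP.
Qed.

(** Submultiplicativity of norms defined as infima is checked through this
    bound, with [s] and [t] running through admissible values. *)
Lemma ler_mul_limit (R : realType) (a b x : R) : 0 <= a -> 0 <= b ->
  (forall s t, a < s -> b < t -> x <= s * t) -> x <= a * b.
Proof.
move=> a0 b0 bnd; apply/ler_addgt0Pr => d d0.
pose c := Num.min 1 (d / (a + b + 1)).
have ab0 : 0 < a + b + 1 by lra.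
have c0 : 0 < c by rewrite lt_min ltr01 divr_gt0.
have c1 : c <= 1 by rewrite ge_min lexx.
have cd : c * (a + b + 1) <= d by rewrite -ler_pdivlMr// ge_min lexx orbT.
have := bnd (a + c) (b + c); rewrite !ltrDl => /(_ c0 c0) /le_trans; apply.
nra.
Qed.

(** * C*-seminorms *)

(** Only one inequality of the C*-identity is required: with
    submultiplicativity it forces the star to be isometric, hence equality. *)
Record cstar_seminorm (R : realType) (A : starAlgType R) := CstarSeminorm {
  csn :> A -> R;
  csn_ge0 : forall x, 0 <= csn x;
  csnD : forall x y, csn (x + y) <= csn x + csn y;
  csnZ : forall (z : R[i]) x, csn (z *: x) = normc z * csn x;
  csnM : forall x y, csn (x ** y) <= csn x * csn y;
  csn_cstar_le : forall x, csn x ^+ 2 <= csn (star x ** x)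
}.

Section SeminormTheory.
Context {R : realType} {A : starAlgType R} (N : cstar_seminorm A).

Lemma csn0 : N 0 = 0.
Proof. by rewrite -(scale0r 0) csnZ normc0 mul0r. Qed.

Lemma csnN x : N (- x) = N x.
Proof.
by rewrite -scaleN1r csnZ -(rmorphN1 (real_complex R)) normcC normrN1 mul1r.
Qed.

Lemma csnB x y : N (x - y) <= N x + N y.
Proof. by rewrite -(csnN y) csnD. Qed.

Lemma csnZR (r : R) x : N (r%:C *: x) = `|r| * N x.
Proof. by rewrite csnZ normcC. Qed.

Lemma csn_star x : N (star x) = N x.
Proof.
suff le_star y : N y <= N (star y).
  by apply/le_anti; rewrite le_star -{2}(starK x) le_star.
have [->|y0] := eqVneq (N y) 0; first exact: csn_ge0.
rewrite -(@ler_pM2r _ (N y)) ?lt_def ?y0 ?csn_ge0//.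
by rewrite -expr2 (le_trans (csn_cstar_le _ _))// csnM.
Qed.

Lemma csn_cstar x : N (star x ** x) = N x ^+ 2.
Proof.
apply/le_anti; rewrite csn_cstar_le andbT (le_trans (csnM _ _ _))//.
by rewrite csn_star.
Qed.

(** * The quotient by the kernel of a C*-seminorm *)

Definition csn_ker : {pred A} := fun x => N x == 0.

Fact csn_ker_zmod : zmod_closed csn_ker.
Proof.
split=> [|x y]; rewrite /in_mem /= /csn_ker ?csn0// => /eqP x0 /eqP y0.
by rewrite eq_le csn_ge0 andbT (le_trans (csnB _ _))// x0 y0 addr0.
Qed.

HB.instance Definition _ := GRing.isZmodClosed.Build A csn_ker csn_ker_zmod.

Definition csn_quot : Type := {ideal_quot csn_ker}.
HB.instance Definition _ := GRing.Zmodule.on csn_quot.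
HB.instance Definition _ := EqQuotient.on csn_quot.

Implicit Types (p q r : csn_quot) (z : R[i]) (x y : A).

Definition csn_class x : csn_quot := \pi_csn_quot x.

Lemma csn_classP x y : csn_class x = csn_class y <-> N (x - y) = 0.
Proof.
rewrite /csn_class; split => [/eqP|/eqP h].
  by rewrite -(Quotient.idealrBE csn_ker) => /eqP.
by apply/eqP; rewrite -(Quotient.idealrBE csn_ker).
Qed.

Lemma csn_class_repr p : csn_class (repr p) = p.
Proof. exact: reprK. Qed.

Lemma csn_reprB x : N (repr (csn_class x) - x) = 0.
Proof. by apply/csn_classP; rewrite csn_class_repr. Qed.

Lemma csn_classD x y : csn_class (x + y) = csn_class x + csn_class y.
Proof. exact: (Quotient.pi_add csn_ker). Qed.

Lemma csn_classN x : csn_class (- x) = - csn_class x.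
Proof. exact: (Quotient.pi_opp csn_ker). Qed.

Lemma csn_classB x y : csn_class (x - y) = csn_class x - csn_class y.
Proof. by rewrite csn_classD csn_classN. Qed.

Lemma csn_eq0 x : N x <= 0 -> N x = 0.
Proof. by move=> x0; apply/le_anti; rewrite x0 csn_ge0. Qed.

Lemma csn_eq x y : N (x - y) = 0 -> N x = N y.
Proof.
move=> xy; apply/le_anti/andP; split.
  by rewrite -(subrK y x) (le_trans (csnD _ _ _))// xy add0r.
by rewrite -(subKr x y) (le_trans (csnB _ _))// xy addr0.
Qed.

Definition csn_quot_scale z p : csn_quot := csn_class (z *: repr p).
Definition csn_quot_mul p q : csn_quot := csn_class (repr p ** repr q).
Definition csn_quot_star p : csn_quot := csn_class (star (repr p)).
Definition csn_quot_norm p : R := N (repr p).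

Lemma csn_quot_scaleE z x : csn_quot_scale z (csn_class x) = csn_class (z *: x).
Proof. by apply/csn_classP; rewrite -scalerBr csnZ csn_reprB mulr0. Qed.

Lemma csn_quot_mulE x y :
  csn_quot_mul (csn_class x) (csn_class y) = csn_class (x ** y).
Proof.
apply/csn_classP/csn_eq0.
rewrite -(subrK (x ** repr (csn_class y)) (_ ** repr _)) -smulrBl.
rewrite -addrA -smulrBr (le_trans (csnD _ _ _))//.
rewrite -(addr0 0) lerD// (le_trans (csnM _ _ _))//.
  by rewrite csn_reprB mul0r.
by rewrite csn_reprB mulr0.
Qed.

Lemma csn_quot_starE x : csn_quot_star (csn_class x) = csn_class (star x).
Proof. by apply/csn_classP; rewrite -starB csn_star csn_reprB. Qed.

Lemma csn_quot_normE x : csn_quot_norm (csn_class x) = N x.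
Proof. exact/csn_eq/csn_reprB. Qed.

(** Identities in the quotient are checked on classes of elements. *)
Lemma csn_quotW (P : csn_quot -> Prop) : (forall x, P (csn_class x)) ->
  forall p, P p.
Proof. by move=> h p; rewrite -(csn_class_repr p). Qed.

Let quotE := (csn_quot_scaleE, csn_quot_mulE, csn_quot_starE,
  csn_quot_normE, =^~ csn_classD, =^~ csn_classN).

Fact csn_quot_scaleA z1 z2 p :
  csn_quot_scale z1 (csn_quot_scale z2 p) = csn_quot_scale (z1 * z2) p.
Proof. by elim/csn_quotW: p => x; rewrite !quotE scalerA. Qed.

Fact csn_quot_scale1 : left_id 1 csn_quot_scale.
Proof. by elim/csn_quotW => x; rewrite !quotE scale1r. Qed.

Fact csn_quot_scaleDr : right_distributive csn_quot_scale +%R.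
Proof.
by move=> z; elim/csn_quotW=> x; elim/csn_quotW=> y; rewrite !quotE scalerDr.
Qed.

Fact csn_quot_scaleDl p : {morph csn_quot_scale^~ p : z1 z2 / z1 + z2}.
Proof. by elim/csn_quotW: p => x z1 z2; rewrite !quotE scalerDl. Qed.

HB.instance Definition _ := GRing.Zmodule_isLmodule.Build R[i] csn_quot
  csn_quot_scaleA csn_quot_scale1 csn_quot_scaleDr csn_quot_scaleDl.

Lemma csn_classZ z x : csn_class (z *: x) = z *: csn_class x.
Proof. by rewrite -csn_quot_scaleE. Qed.

Fact csn_quot_mulA : associative csn_quot_mul.
Proof.
elim/csn_quotW=> x; elim/csn_quotW=> y; elim/csn_quotW=> t.
by rewrite !quotE smulA.
Qed.

Fact csn_quot_mulDl : left_distributive csn_quot_mul +%R.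
Proof.
elim/csn_quotW=> x; elim/csn_quotW=> y; elim/csn_quotW=> t.
by rewrite !quotE smulDl.
Qed.

Fact csn_quot_mulDr : right_distributive csn_quot_mul +%R.
Proof.
elim/csn_quotW=> x; elim/csn_quotW=> y; elim/csn_quotW=> t.
by rewrite !quotE smulDr.
Qed.

Fact csn_quot_mulZl z p q : csn_quot_mul (z *: p) q = z *: csn_quot_mul p q.
Proof.
elim/csn_quotW: p => x; elim/csn_quotW: q => y.
by rewrite -csn_classZ !quotE smulZl csn_classZ.
Qed.

Fact csn_quot_mulZr z p q : csn_quot_mul p (z *: q) = z *: csn_quot_mul p q.
Proof.
elim/csn_quotW: p => x; elim/csn_quotW: q => y.
by rewrite -csn_classZ !quotE smulZr csn_classZ.
Qed.

Fact csn_quot_starK : involutive csn_quot_star.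
Proof. by elim/csn_quotW=> x; rewrite !quotE starK. Qed.

Fact csn_quot_starD : {morph csn_quot_star : p q / p + q}.
Proof. by elim/csn_quotW=> x; elim/csn_quotW=> y; rewrite !quotE starD. Qed.

Fact csn_quot_starM p q :
  csn_quot_star (csn_quot_mul p q) =
  csn_quot_mul (csn_quot_star q) (csn_quot_star p).
Proof.
by elim/csn_quotW: p => x; elim/csn_quotW: q => y; rewrite !quotE starM.
Qed.

Fact csn_quot_starZ z p : csn_quot_star (z *: p) = z^* *: csn_quot_star p.
Proof.
by elim/csn_quotW: p => x; rewrite -csn_classZ !quotE starZ csn_classZ.
Qed.

HB.instance Definition _ := isStarAlgebra.Build R csn_quot
  csn_quot_mulA csn_quot_mulDl csn_quot_mulDr csn_quot_mulZl csn_quot_mulZr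
  csn_quot_starK csn_quot_starD csn_quot_starM csn_quot_starZ.

Lemma csn_class_star_hom : star_hom csn_class.
Proof.
split=> [z x y|x y|x]; first by rewrite csn_classD csn_classZ.
  by rewrite -csn_quot_mulE.
by rewrite -csn_quot_starE.
Qed.

Fact csn_quot_normD p q : (csn_quot_norm (p + q))%:C <=
  (csn_quot_norm p)%:C + (csn_quot_norm q)%:C.
Proof.
rewrite -rmorphD lecR.
by elim/csn_quotW: p => x; elim/csn_quotW: q => y; rewrite !quotE csnD.
Qed.

Fact csn_quot_normZ z p :
  (csn_quot_norm (z *: p))%:C = `|z| * (csn_quot_norm p)%:C.
Proof.
rewrite -[`|z|]/((normc z)%:C) -rmorphM.
by elim/csn_quotW: p => x; rewrite -csn_classZ !quotE csnZ.
Qed.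

Fact csn_quot_norm0 p : (csn_quot_norm p)%:C = 0 -> p = 0.
Proof.
elim/csn_quotW: p => x; rewrite quotE => -[x0].
by rewrite -(subrr (csn_class 0)) -csn_classB; apply/csn_classP; rewrite !subr0.
Qed.

HB.instance Definition _ := Lmodule_isNormed.Build R[i] csn_quot
  csn_quot_normD csn_quot_normZ csn_quot_norm0.

Lemma csn_norm_class x : `|csn_class x| = (N x)%:C.
Proof. by rewrite -csn_quot_normE. Qed.

End SeminormTheory.

(** * Bounded sequences with the limsup seminorm *)

Section BoundedSequences.
Context {R : realType} {A : starAlgType R} (N : cstar_seminorm A).

Definition bdd : {pred nat -> A} :=
  fun u => `[< exists M, forall n, N (u n) <= M >].

Lemma bddP (u : nat -> A) :
  reflect (exists M, forall n, N (u n) <= M) (u \in bdd).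
Proof. exact: asboolP. Qed.

Fact bdd_submod : submod_closed bdd.
Proof.
split=> [|z u v /bddP[M uM] /bddP[M' vM]]; apply/bddP.
  by exists 0 => n; rewrite /= csn0.
exists (normc z * M + M') => n.
by rewrite (le_trans (csnD _ _ _))// csnZ lerD// ler_wpM2l ?normc_ge0.
Qed.

HB.instance Definition _ :=
  GRing.isSubmodClosed.Build R[i] (nat -> A) bdd bdd_submod.

Record bdd_seq := BddSeq { bdd_fun :> nat -> A; bdd_funP : bdd_fun \in bdd }.
HB.instance Definition _ := [isSub for bdd_fun].
HB.instance Definition _ := [Choice of bdd_seq by <:].
HB.instance Definition _ := [SubChoice_isSubLmodule of bdd_seq by <:].

Implicit Types u v w : bdd_seq.

Lemma bdd_seqP u v : (forall n, u n = v n) -> u = v.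
Proof. by move=> uv; apply/val_inj/funext. Qed.

Lemma bdd_mul u v : (fun n => u n ** v n) \in bdd.
Proof.
have /bddP[M uM] := bdd_funP u; have /bddP[M' vM] := bdd_funP v.
apply/bddP; exists (M * M') => n.
by rewrite (le_trans (csnM _ _ _))// ler_pM ?csn_ge0.
Qed.

Lemma bdd_star u : (fun n => star (u n)) \in bdd.
Proof.
by have /bddP[M uM] := bdd_funP u; apply/bddP; exists M => n; rewrite csn_star.
Qed.

Definition bdd_seq_mul u v : bdd_seq := BddSeq (bdd_mul u v).
Definition bdd_seq_star u : bdd_seq := BddSeq (bdd_star u).

Fact bdd_seq_mulA : associative bdd_seq_mul.
Proof. by move=> u v w; apply: bdd_seqP => n; apply: smulA. Qed.

Fact bdd_seq_mulDl : left_distributive bdd_seq_mul +%R.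
Proof. by move=> u v w; apply: bdd_seqP => n; apply: smulDl. Qed.

Fact bdd_seq_mulDr : right_distributive bdd_seq_mul +%R.
Proof. by move=> u v w; apply: bdd_seqP => n; apply: smulDr. Qed.

Fact bdd_seq_mulZl z u v : bdd_seq_mul (z *: u) v = z *: bdd_seq_mul u v.
Proof. by apply: bdd_seqP => n; apply: smulZl. Qed.

Fact bdd_seq_mulZr z u v : bdd_seq_mul u (z *: v) = z *: bdd_seq_mul u v.
Proof. by apply: bdd_seqP => n; apply: smulZr. Qed.

Fact bdd_seq_starK : involutive bdd_seq_star.
Proof. by move=> u; apply: bdd_seqP => n; apply: starK. Qed.

Fact bdd_seq_starD : {morph bdd_seq_star : u v / u + v}.
Proof. by move=> u v; apply: bdd_seqP => n; apply: starD. Qed.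

Fact bdd_seq_starM u v :
  bdd_seq_star (bdd_seq_mul u v) = bdd_seq_mul (bdd_seq_star v) (bdd_seq_star u).
Proof. by apply: bdd_seqP => n; apply: starM. Qed.

Fact bdd_seq_starZ z u : bdd_seq_star (z *: u) = z^* *: bdd_seq_star u.
Proof. by apply: bdd_seqP => n; apply: starZ. Qed.

HB.instance Definition _ := isStarAlgebra.Build R bdd_seq
  bdd_seq_mulA bdd_seq_mulDl bdd_seq_mulDr bdd_seq_mulZl bdd_seq_mulZr
  bdd_seq_starK bdd_seq_starD bdd_seq_starM bdd_seq_starZ.

(** The limsup of the norms is encoded as the infimum of the eventual bounds:
    every estimate below then is an estimate of finitely many such bounds. *)
Definition ultimate_bounds u : set R :=
  [set t | exists n0, forall n, (n0 <= n)%N -> N (u n) <= t].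

Definition limsup_norm u : R := inf (ultimate_bounds u).

Lemma ultimate_bounds_ge0 u t : ultimate_bounds u t -> 0 <= t.
Proof. by move=> [n0 /(_ n0 (leqnn _))]; apply: le_trans; apply: csn_ge0. Qed.

Lemma ultimate_bounds_has_inf u : has_inf (ultimate_bounds u).
Proof.
split; last by exists 0 => t /ultimate_bounds_ge0.
by have /bddP[M uM] := bdd_funP u; exists M, 0%N.
Qed.

Lemma limsup_norm_le u t n0 :
  (forall n, (n0 <= n)%N -> N (u n) <= t) -> limsup_norm u <= t.
Proof.
move=> h; apply: ge_inf; last by exists n0.
by case: (ultimate_bounds_has_inf u).
Qed.

Lemma limsup_norm_lt u t : limsup_norm u < t ->
  exists n0, forall n, (n0 <= n)%N -> N (u n) <= t.
Proof.
move=> ut; have /(inf_adherent)/(_ (ultimate_bounds_has_inf u))[s [n0 us]] :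
  0 < t - limsup_norm u by rewrite subr_gt0.
rewrite addrC subrK => st; exists n0 => n /us /le_trans; apply; exact: ltW.
Qed.

Lemma limsup_norm_ge0 u : 0 <= limsup_norm u.
Proof.
apply: lb_le_inf; first by case: (ultimate_bounds_has_inf u).
by move=> t /ultimate_bounds_ge0.
Qed.

Fact limsup_normD u v : limsup_norm (u + v) <= limsup_norm u + limsup_norm v.
Proof.
apply/ler_addgt0Pl => e e0.
have /limsup_norm_lt[n1 un] : limsup_norm u < limsup_norm u + e / 2.
  by rewrite ltrDl divr_gt0.
have /limsup_norm_lt[n2 vn] : limsup_norm v < limsup_norm v + e / 2.
  by rewrite ltrDl divr_gt0.
apply: (@limsup_norm_le _ _ (maxn n1 n2)) => n; rewrite geq_max => /andP[h1 h2].
rewrite (le_trans (csnD _ _ _))//; have := un n h1; have := vn n h2; lra.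
Qed.

Lemma limsup_normZ_le z u : limsup_norm (z *: u) <= normc z * limsup_norm u.
Proof.
have [->|z0] := eqVneq z 0.
  rewrite normc0 mul0r; apply: (@limsup_norm_le _ _ 0%N) => n _.
  by rewrite [bdd_fun _ _]scale0r csn0.
have nz0 := normc_gt0 z0.
rewrite -ler_pdivrMl//; apply/ler_addgt0Pl => e e0; rewrite ler_pdivrMl//.
have /limsup_norm_lt[n0 un] : limsup_norm u < e + limsup_norm u by rewrite ltrDr.
by apply: (@limsup_norm_le _ _ n0) => n /un h; rewrite csnZ ler_wpM2l// ltW.
Qed.

Fact limsup_normZ z u : limsup_norm (z *: u) = normc z * limsup_norm u.
Proof.
apply/le_anti; rewrite limsup_normZ_le /=.
have [->|z0] := eqVneq z 0; first by rewrite normc0 mul0r limsup_norm_ge0.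
have nz0 := normc_gt0 z0.
rewrite -ler_pdivlMl// -normcV.
by rewrite -{1}(scale1r u) -(mulVf z0) -scalerA limsup_normZ_le.
Qed.

Fact limsup_normM u v : limsup_norm (u ** v) <= limsup_norm u * limsup_norm v.
Proof.
apply: ler_mul_limit => [||s t]; rewrite ?limsup_norm_ge0//.
move=> /limsup_norm_lt[n1 un] /limsup_norm_lt[n2 vn].
apply: (@limsup_norm_le _ _ (maxn n1 n2)) => n.
rewrite geq_max => /andP[h1 h2].
by rewrite (le_trans (csnM _ _ _))// ler_pM ?csn_ge0 ?un ?vn.
Qed.

Fact limsup_norm_cstar_le u : limsup_norm u ^+ 2 <= limsup_norm (star u ** u).
Proof.
have u0 := limsup_norm_ge0 u; have uu0 := limsup_norm_ge0 (star u ** u).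
rewrite -[leRHS]sqr_sqrtr// ler_pXn2r ?nnegrE ?sqrtr_ge0//.
apply/ler_addgt0Pr => e e0; set s := Num.sqrt _ + e.
have s0 : 0 < s by rewrite ltr_wpDl ?sqrtr_ge0.
have /limsup_norm_lt[n0 un] : limsup_norm (star u ** u) < s ^+ 2.
  rewrite -[ltLHS]sqr_sqrtr// ltr_pXn2r ?nnegrE ?sqrtr_ge0 ?(ltW s0)//.
  by rewrite ltrDl.
apply: (@limsup_norm_le _ _ n0) => n /un; rewrite csn_cstar ler_pXn2r ?nnegrE//.
  exact: csn_ge0.
exact: ltW.
Qed.

Definition limsup_seminorm : cstar_seminorm bdd_seq :=
  CstarSeminorm limsup_norm_ge0 limsup_normD limsup_normZ limsup_normM
    limsup_norm_cstar_le.

End BoundedSequences.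

(** * The completion of a C*-seminormed algebra *)

Lemma half_pow_gt0 (R : realType) k : 0 < 2^-1 ^+ k :> R.
Proof. by rewrite exprn_gt0 ?invr_gt0 ?ltr0n. Qed.

Lemma half_pow_small (R : realType) (e : R) :
  0 < e -> exists k, 3 * 2^-1 ^+ k < e.
Proof.
move=> e0; exists (Num.bound (3 / e)).
have := archi_boundP (divr_ge0 (ler0n R 3) (ltW e0)).
rewrite ltr_pdivrMr// => /lt_le_trans h; rewrite exprVn ltr_pdivrMr ?exprn_gt0//.
by apply: h; rewrite mulrC ler_pM2l// -natrX ler_nat ltnW// ltn_expl.
Qed.

Section Completeness.
Context {R : realType} {A : starAlgType R} (N : cstar_seminorm A).
Local Notation L := (limsup_seminorm N).

Section FastCauchy.
Variable u : nat -> bdd_seq N.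
Hypothesis u_fast : forall k, L (u k.+1 - u k) < 2^-1 ^+ k.

(* The increments of u, truncated so that the bound on the j-th one holds at
   every index n and not only eventually. *)
Let step j n : A :=
  if N (u j.+1 n - u j n) <= 2^-1 ^+ j then u j.+1 n - u j n else 0.

(* Diagonal limit: the first k increments are eventually the true ones, so that
   diag n - u k n is a tail of the sum. *)
Let diag n : A := u 0%N n + \sum_(0 <= j < n) step j n.

Let step_le j n : N (step j n) <= 2^-1 ^+ j.
Proof. by rewrite /step; case: ifP => // _; rewrite csn0 ltW// half_pow_gt0. Qed.

Let step_sum_le a b n : (a <= b)%N ->
  N (\sum_(a <= j < b) step j n) <= 2 * 2^-1 ^+ a.
Proof.
move=> ab.
have : N (\sum_(a <= j < b) step j n) <= 2 * 2^-1 ^+ a - 2 * 2^-1 ^+ b.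
  elim: b ab => [|b IH]; rewrite leq_eqVlt => /predU1P[->|].
  - by rewrite big_geq// csn0 subrr.
  - by [].
  - by rewrite big_geq// csn0 subrr.
  rewrite ltnS => ab; rewrite big_nat_recr//= (le_trans (csnD _ _ _))//.
  have := IH ab; have := step_le b n; rewrite (exprS _ b).
  have := half_pow_gt0 R b; lra.
by move/le_trans; apply; rewrite gerBl mulr_ge0// ltW// half_pow_gt0.
Qed.

Let diag_bdd : diag \in bdd N.
Proof.
have /bddP[M uM] := bdd_funP (u 0%N); apply/bddP; exists (M + 2) => n.
rewrite (le_trans (csnD _ _ _))// lerD//.
by rewrite (le_trans (step_sum_le _ _))// expr0 mulr1.
Qed.

Let step_eventually k : exists n0, forall n, (n0 <= n)%N ->
  u 0%N n + \sum_(0 <= j < k) step j n = u k n.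
Proof.
elim: k => [|k [n1 IH]]; first by exists 0%N => n _; rewrite big_geq// addr0.
have [n2 h2] := limsup_norm_lt (u_fast k).
exists (maxn n1 n2) => n; rewrite geq_max => /andP[/IH h /h2 hk].
rewrite big_nat_recr//= addrA h /step ifT//.
by rewrite addrC subrK.
Qed.

(** A sequence of bounded sequences with summable increments has a limit that is
    again a sequence in [A]; the completeness of [A] does not matter. *)
Lemma bdd_seq_complete : exists v, forall k, L (v - u k) <= 2 * 2^-1 ^+ k.
Proof.
exists (BddSeq diag_bdd) => k; have [n0 h] := step_eventually k.
apply: (@limsup_norm_le _ _ _ _ _ (maxn n0 k)) => n.
rewrite geq_max => /andP[/h hk kn].
rewrite -[X in N X <= _]/(diag n - u k n) -hk /diag (big_cat_nat _ kn)//=.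
  by rewrite opprD addrACA subrr add0r addrAC subrr add0r; apply: step_sum_le.
Qed.

End FastCauchy.

Definition completion : Type := csn_quot L.
HB.instance Definition _ := StarAlgebra.on completion.
HB.instance Definition _ := NormedModule.on completion.

Fact completion_complete (F : set_system completion) :
  ProperFilter F -> cauchy F -> cvg F.
Proof.
move=> FF /cauchyP/= Fc.
have /choice[x Fx] k : exists x : completion,
    F (ball x ((2^-1 ^+ k.+2 : R)%:C)).
  by apply: Fc; rewrite ltcR half_pow_gt0.
pose u k : bdd_seq N := repr (x k).
have ux k : csn_class L (u k) = x k by apply: csn_class_repr.
have dist k : L (u k.+1 - u k) < 2^-1 ^+ k.
  rewrite -ltcR -csn_norm_class csn_classB !ux.
  have [y [/= yk yk1]] := filter_ex (filterI (Fx k) (Fx k.+1)).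
  move: yk yk1; rewrite -!ball_normE /= => yk yk1.
  rewrite -(subrK y (x k.+1)) -addrA (le_lt_trans (ler_normD _ _))//.
  rewrite (distrC y).
  have := ltrD yk1 yk; move/lt_trans; apply.
  rewrite -rmorphD ltcR !exprS; have := half_pow_gt0 R k; lra.
have [v uv] := bdd_seq_complete dist.
apply/cvg_ex; exists (csn_class L v); apply/fcvgrPdist_lt => e e0.
have eE : e = (complex.Re e)%:C by rewrite RRe_real// gtr0_real.
rewrite eE ltcR in e0; have [k ke] := half_pow_small e0.
near=> y.
have : ball (x k) ((2^-1 ^+ k.+2 : R)%:C) y by near: y; exact: Fx.
rewrite -ball_normE /= => xy.
rewrite -(subrK (x k) (csn_class L v)) -addrA (le_lt_trans (ler_normD _ _))//.
rewrite -ux -csn_classB csn_norm_class ux.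
rewrite (@le_lt_trans _ _ ((2 * 2^-1 ^+ k)%:C + (2^-1 ^+ k.+2)%:C))//.
  by apply: lerD; [rewrite lecR uv|exact: ltW].
rewrite eE -rmorphD ltcR; apply: le_lt_trans ke; rewrite !exprS.
have := half_pow_gt0 R k; lra.
Unshelve. all: by end_near. Qed.

HB.instance Definition _ := Uniform_isComplete.Build completion
  completion_complete.

Fact completion_normM (x y : completion) : `|x ** y| <= `|x| * `|y|.
Proof.
elim/(@csn_quotW _ _ L): x => x; elim/(@csn_quotW _ _ L): y => y.
have [_ hM _] := csn_class_star_hom L.
by rewrite -[_ ** _]hM !csn_norm_class -rmorphM lecR csnM.
Qed.

Fact completion_cstar (x : completion) : `|star x ** x| = `|x| ^+ 2.
Proof.
elim/(@csn_quotW _ _ L): x => x.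
have [_ hM hs] := csn_class_star_hom L.
by rewrite -[star _]hs -[_ ** _]hM !csn_norm_class -rmorphXn csn_cstar.
Qed.

HB.instance Definition _ := isCstarAlgebra.Build R completion
  completion_normM completion_cstar.

Fact cst_bdd (a : A) : (fun=> a) \in bdd N.
Proof. by apply/bddP; exists (N a). Qed.

Definition to_completion (a : A) : completion := csn_class L (BddSeq (cst_bdd a)).

Lemma to_completion_star_hom : star_hom to_completion.
Proof.
have [hl hM hs] := csn_class_star_hom L.
split=> [z x y|x y|x]; rewrite /to_completion -?hl -?hM -?hs; congr csn_class;
  exact: bdd_seqP.
Qed.

Lemma norm_to_completion a : `|to_completion a| = (N a)%:C.
Proof.
rewrite csn_norm_class; congr _%:C; apply/le_anti/andP; split.
  exact: (@limsup_norm_le _ _ _ _ _ 0%N).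
apply/ler_addgt0Pr => e e0; have : limsup_norm (BddSeq (cst_bdd a)) <
  limsup_norm (BddSeq (cst_bdd a)) + e by rewrite ltrDl.
by case/limsup_norm_lt => n0 /(_ n0 (leqnn _)).
Qed.

End Completeness.

(** * Positivity in a unital C*-seminormed algebra *)

Definition smulE {R A} := (@smulDl R A, @smulDr R A, @smulNr R A, @smulrN R A,
  @smulZl R A, @smulZr R A).

Lemma bernoulli_le (R : realType) (c : R) n : 1 <= c -> 1 + (c - 1) *+ n <= c ^+ n.
Proof.
move=> c1; elim: n => [|n IH]; first by rewrite mulr0n addr0 expr0.
rewrite exprS; have : 0 <= (c - 1) *+ n by rewrite mulrn_wge0// subr_ge0.
move: IH; rewrite mulrSr; set t := _ *+ n; set u := _ ^+ n; nra.
Qed.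

Lemma pow_unbounded (R : realType) (c M : R) : 1 < c -> exists n, M < c ^+ n.
Proof.
move=> c1; exists (Num.bound (`|M| / (c - 1))).
apply: lt_le_trans (bernoulli_le _ (ltW c1)).
have := archi_boundP (divr_ge0 (normr_ge0 M) (_ : 0 <= c - 1)).
rewrite subr_ge0 ltW// => /(_ isT); rewrite ltr_pdivrMr ?subr_gt0// => h.
rewrite -mulr_natl; have := ler_norm M; lra.
Qed.

(** If [t > 1], the left side at [m.+1] is at least quadratic in [2 ^ m], by
    Bernoulli, while the right side is linear in it. *)
Lemma le1_of_pow_le (R : realType) (t C : R) :
  (forall m, t ^+ (2 ^ m) <= 1 + 2 ^+ m * C) -> t <= 1.
Proof.
move=> h; rewrite leNgt; apply/negP => t1.
have d0 : 0 < t - 1 by rewrite subr_gt0.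
have d2 : 0 < (t - 1) ^+ 2 by rewrite exprn_gt0.
have [m] := pow_unbounded ((1 + 2 * `|C|) / (t - 1) ^+ 2) (ltr1n R 2).
rewrite ltr_pdivrMr// => hm.
have := h m.+1; rewrite expnSr exprM.
have := bernoulli_le (2 ^ m) (ltW t1).
rewrite -[_ *+ (2 ^ m)]mulr_natr natrX (exprS _ m).
have : 1 <= 2 ^+ m :> R by rewrite exprn_ege1// ler1n.
have := ler_norm C; have := normr_ge0 C.
move: hm; set P := 2 ^+ m; set D := t - 1; set Q := t ^+ _; set c := `|C|.
move=> hm c0 Cc P1 hQ hQ2.
have DP : 0 <= D * P by rewrite mulr_ge0// ltW// (lt_le_trans ltr01).
have Q2 : D ^+ 2 * P ^+ 2 <= Q ^+ 2.
  by rewrite -exprMn ler_pXn2r ?nnegrE//; lra.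
have : P * D ^+ 2 * P <= 1 + 2 * c * P.
  have : P * C <= P * c by rewrite ler_pM2l// (lt_le_trans ltr01).
  lra.
have : (1 + 2 * c) * P < P * D ^+ 2 * P.
  by rewrite ltr_pM2r// (lt_le_trans ltr01).
lra.
Qed.

Section UnitalSeminorm.
Context {R : realType} {A : starAlgType R} (N : cstar_seminorm A) (e : A).
Hypothesis e1 : is_identity e.
Implicit Types a b c h x y : A.

Lemma smul1r a : e ** a = a. Proof. by case: (e1 a). Qed.
Lemma smulr1 a : a ** e = a. Proof. by case: (e1 a). Qed.

Lemma star_identity : star e = e.
Proof. by rewrite -[RHS]starK -[star e in RHS]smulr1 starM starK smulr1. Qed.

Lemma starMn a n : star (a *+ n) = star a *+ n.
Proof. by elim: n => [|n IH]; rewrite ?mulr0n ?star0// !mulrSr starD IH. Qed.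

Lemma csnMn x n : N (x *+ n) = N x *+ n.
Proof.
by rewrite -scaler_nat -(rmorph_nat (real_complex R)) csnZR normr_nat mulr_natl.
Qed.

Lemma csn_sa a : self_adjoint a -> N (a ** a) = N a ^+ 2.
Proof. by move=> sa; rewrite -{1}sa csn_cstar. Qed.

Lemma csn_identity : N e <= 1.
Proof.
have := csn_sa star_identity; rewrite smul1r => h.
have := csn_ge0 N e; nra.
Qed.

(** For commuting self-adjoint [a] and [b] the right side is the squared norm
    of [a + i b], and [a] is the average of this element and of its star.  This
    replaces the comparison of [a ** a] with a larger positive element. *)
Lemma csn_sqr_le a b : self_adjoint a -> self_adjoint b -> a ** b = b ** a ->
  N (a ** a) <= N (a ** a + b ** b).
Proof.
move=> sa sb ab; pose u := a + 'i *: b.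
have su : star u = a - 'i *: b.
  rewrite starD starZ sa sb; congr (_ + _); rewrite -scaleNr; congr (_ *: _).
  by apply/eqP; rewrite eq_complex /= ?oppr0 !eqxx.
have uu : star u ** u = a ** a + b ** b.
  rewrite su /u !smulE ab.
  have ii : 'i * 'i = -1 :> R[i] by rewrite -expr2 sqr_i.
  rewrite !scalerA.
  by rewrite ?mulNr ii; lmod_eq.
have uN : N u ^+ 2 = N (a ** a + b ** b) by rewrite -uu csn_cstar.
rewrite -uN csn_sa// ler_pXn2r ?nnegrE ?csn_ge0//.
have : N (a *+ 2) <= N u *+ 2.
  have -> : a *+ 2 = u + star u by rewrite su /u; lmod_eq.
  by rewrite mulr2n -{2}(csn_star N u) csnD.
by rewrite csnMn lerMn2r.
Qed.

Local Notation scal := (@trivext_scalar R[i] A).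

(** With [w = 3 e + 2 (1 + i) h] one has
    [w^* w = 7 (e + h)^2 + (e - h)^2 + e] and
    [w^2 + w'^2 = 18 e + 24 h], where [w' = w^*]; the first identity bounds
    [N w] by 3, and then the second gives the claim.  The point is that the
    factor 4/3 exceeds 1, so that the step can be iterated. *)
Lemma csn_expand h : self_adjoint h -> N (e + h) <= 1 -> N (e - h) <= 1 ->
  N (e + (4 / 3 : R)%:C *: h) <= 1.
Proof.
move=> sh hp hm.
have sq_le x : N x <= 1 -> N (x ** x) <= 1.
  by move=> x1; rewrite (le_trans (csnM _ _ _))// mulr_ile1 ?csn_ge0.
have ii : 'i * 'i = -1 :> R[i] by rewrite -expr2 sqr_i.
pose z : R[i] := 2 * (1 + 'i); pose z' : R[i] := 2 * (1 - 'i).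
have zC : z^* = z'.
  by apply/eqP; rewrite eq_complex /= ?oppr0; apply/andP; split; apply/eqP; ring.
have zE : scal z = 4%:R - scal z'.
  by rewrite -(rmorph_nat scal) -rmorphB; congr scal; rewrite /z /z'; ring.
(* z and its conjugate are the roots of x^2 = 4 x - 8 *)
have z2 : scal z' * scal z' = 4%:R * scal z' - 8%:R.
  rewrite -(rmorph_nat scal 4) -(rmorph_nat scal 8) -!rmorphM -rmorphB.
  by congr scal; rewrite /z'; ring: ii.
pose w := e *+ 3 + z *: h.
have sw : star w = e *+ 3 + z' *: h.
  by rewrite starD starZ sh starMn star_identity zC.
have w3 : N w <= 3.
  have : N (star w ** w) <= 9.
    have -> : star w ** w =
        ((e + h) ** (e + h)) *+ 7 + (e - h) ** (e - h) + e.
      rewrite sw /w !mulrSr !mulr0n !add0r !smulE !smul1r !smulr1.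
      by apply: trivext_vector_inj; rewrite !trivextE zE; ring: z2.
    rewrite (le_trans (csnD _ _ _))// (le_trans (lerD (csnD _ _ _) (lexx _)))//.
    rewrite csnMn.
    have := sq_le _ hp; have := sq_le _ hm; have := csn_identity.
    set a := N _; set b := N _; set c := N _; lra.
  rewrite csn_cstar; have := csn_ge0 N w; nra.
have : N ((e + (4 / 3 : R)%:C *: h) *+ 18) <= 18.
  have -> : (e + (4 / 3 : R)%:C *: h) *+ 18 = w ** w + star w ** star w.
    have -> : (e + (4 / 3 : R)%:C *: h) *+ 18 = e *+ 18 + h *+ 24.
      rewrite mulrnDl; congr (_ + _); rewrite scalerMnl -rmorphMn.
      have -> : (4 / 3) *+ 18 = 24%:R :> R by rewrite -mulr_natr; field.
      by rewrite rmorph_nat scaler_nat.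
    rewrite sw /w !mulrSr !mulr0n !add0r !smulE !smul1r !smulr1.
    by apply: trivext_vector_inj; rewrite !trivextE zE; ring: z2.
  rewrite (le_trans (csnD _ _ _))// (le_trans (lerD (csnM _ _ _) (csnM _ _ _)))//.
  rewrite csn_star; have := csn_ge0 N w; nra.
by rewrite csnMn -mulr_natl; lra.
Qed.

(** Iterating [csn_expand] keeps [e + (4/3)^n h] and [e - (4/3)^n h] in the unit
    ball for all [n], while their difference grows unless [N h = 0]. *)
Lemma csn_extreme h : self_adjoint h -> N (e + h) <= 1 -> N (e - h) <= 1 ->
  N h = 0.
Proof.
move=> sh hp hm; pose c : R := 4 / 3.
have cN n : N (e + (c ^+ n)%:C *: h) <= 1 /\ N (e - (c ^+ n)%:C *: h) <= 1.
  elim: n => [|n [IHp IHm]]; first by rewrite expr0 scale1r.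
  have sn : self_adjoint ((c ^+ n)%:C *: h).
    by rewrite /self_adjoint starZR sh.
  rewrite exprS rmorphM -scalerA; split; first exact: csn_expand.
  rewrite -scalerN; apply: csn_expand; rewrite ?opprK//.
  by rewrite /self_adjoint starN sn.
apply/le_anti; rewrite csn_ge0 andbT leNgt; apply/negP => h0.
have c1 : 1 < c by rewrite /c; lra.
have [n] := pow_unbounded (2 / N h) c1; rewrite ltr_pdivrMr// => h2.
have : N (((c ^+ n)%:C *: h) *+ 2) <= 2.
  have -> : ((c ^+ n)%:C *: h) *+ 2 =
    (e + (c ^+ n)%:C *: h) - (e - (c ^+ n)%:C *: h) by lmod_eq.
  by rewrite (le_trans (csnB _ _ _))//; have [] := cN n; lra.
rewrite csnMn csnZR ger0_norm ?exprn_ge0 ?divr_ge0//.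
move: h2; rewrite -/c; set t := _ * _; lra.
Qed.

(** The norm of the self-adjoint element [e + c c^*] is determined by those of
    its iterated squares, which have the form [e + c d c^*] with [N d] at most
    [2 ^ m]: squaring replaces [d] by [d + f d], where [f = e + d c^* c] is the
    corresponding iterated square of [e + c^* c], of norm at most 1.  Linear
    growth along repeated squaring is possible only for norms at most 1. *)
Lemma csn_flip c : N (e + star c ** c) <= 1 -> N (e + c ** star c) <= 1.
Proof.
move=> hc.
have dbl m : exists z d f : A,
    [/\ [/\ self_adjoint z, N z = N (e + c ** star c) ^+ (2 ^ m),
            z = e + c ** d ** star c & f = e + d ** star c ** c],
        N d <= 2 ^+ m & N f <= 1].
  elim: m => [|m [z [d [f [[sz Nz zE fE] dN fN]]]]].
    exists (e + c ** star c), e, (e + star c ** c).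
    rewrite !smulr1 !smul1r; split => //.
      split=> //; rewrite /self_adjoint starD star_identity starM starK //.
    by rewrite expr0 csn_identity.
  exists (z ** z), (d + f ** d), (f ** f); split; [split|..].
  - by rewrite /self_adjoint starM sz.
  - by rewrite csn_sa// Nz -exprM expnSr.
  - rewrite {1}zE smulDl smul1r {1}zE -addrA; congr (_ + _).
    rewrite zE fE !smulE !smul1r !smulr1 !smulA; lmod_eq.
  - rewrite {1}fE smulDl smul1r {1}fE -addrA; congr (_ + _).
    rewrite fE !smulE !smul1r !smulr1 !smulA; lmod_eq.
  - rewrite (le_trans (csnD _ _ _))// exprS mulr2n mulrDl mul1r lerD//.
    rewrite (le_trans (csnM _ _ _))// (le_trans _ dN)// ler_piMl ?csn_ge0//.
  - by rewrite (le_trans (csnM _ _ _))// mulr_ile1 ?csn_ge0.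
set x := N (e + c ** star c) in dbl *.
have bnd m : x ^+ (2 ^ m) <= 1 + 2 ^+ m * N c ^+ 2.
  have [z [d [f [[_ <- -> _] dN _]]]] := dbl m.
  rewrite (le_trans (csnD _ _ _))// lerD ?csn_identity//.
  rewrite (le_trans (csnM _ _ _))// csn_star.
  have := csnM N c d; have := csn_ge0 N c; nra.
exact: le1_of_pow_le bnd.
Qed.

(** In a C*-algebra this is nonnegativity of the spectrum, for self-adjoint
    [h]. *)
Definition csn_pos h : Prop := exists2 t : R, 0 < t & N (t%:C *: e - h) <= t.

Lemma csn_posD h k : csn_pos h -> csn_pos k -> csn_pos (h + k).
Proof.
move=> [t t0 ht] [s s0 ks]; exists (t + s); first exact: addr_gt0.
rewrite rmorphD scalerDl opprD addrACA (le_trans (csnD _ _ _))//.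
exact: lerD.
Qed.

Lemma csn_posZ (r : R) h : 0 < r -> csn_pos h -> csn_pos (r%:C *: h).
Proof.
move=> r0 [t t0 ht]; exists (r * t); first exact: mulr_gt0.
by rewrite rmorphM -scalerA -scalerBr csnZR gtr0_norm// ler_pM2l.
Qed.

Lemma csn_pos0 : csn_pos 0.
Proof. by exists 1; rewrite // subr0 scale1r csn_identity. Qed.

Lemma csn_pos_unit h : N (e - h) <= 1 -> csn_pos h.
Proof. by move=> h1; exists 1; rewrite // scale1r. Qed.

Lemma csn_pos_extreme h : self_adjoint h -> csn_pos h -> csn_pos (- h) ->
  N h = 0.
Proof.
move=> sh [t t0 ht] [s s0 hs].
have r0 : 0 < s + t by rewrite addr_gt0.
have normalize k : N ((s + t)%:C *: e + k) <= s + t ->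
    N (e + (s + t)^-1%:C *: k) <= 1.
  move=> hk; rewrite -(ler_pM2l r0) mulr1 -[X in X * _](ger0_norm (ltW r0)).
  by rewrite -csnZR scalerDr scalerA -rmorphM divff ?gt_eqF// scale1r.
suff : N ((s + t)^-1%:C *: h) = 0.
  move/eqP; rewrite csnZR mulf_eq0 normr_eq0 invr_eq0 gt_eqF//=.
  by move/eqP.
apply: csn_extreme; first by rewrite /self_adjoint starZR sh.
  apply: normalize; rewrite rmorphD scalerDl addrAC (le_trans (csnD _ _ _))//.
  by rewrite lerD//; [rewrite -[h]opprK|
    rewrite csnZR gtr0_norm// ler_piMr ?csn_identity// ltW].
rewrite -scalerN; apply: normalize.
rewrite rmorphD scalerDl -addrA (le_trans (csnD _ _ _))//.
by rewrite lerD// csnZR gtr0_norm// ler_piMr ?csn_identity// ltW.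
Qed.

End UnitalSeminorm.

(** * Square roots in a unital C*-algebra *)

Section CstarAlgebras.
Context {R : realType} {X : cstarAlgType R}.
Implicit Types a b c g h x y : X.

(** The norm takes its values in [R[i]]; its real part is the same norm with
    values in [R]. *)
Definition cnorm x : R := complex.Re `|x|.

Lemma cnormE x : `|x| = (cnorm x)%:C.
Proof. by rewrite /cnorm RRe_real// normr_real. Qed.

Fact cnorm_ge0 x : 0 <= cnorm x.
Proof. by rewrite -ler0c -cnormE. Qed.

Fact cnormD x y : cnorm (x + y) <= cnorm x + cnorm y.
Proof. by have := ler_normD x y; rewrite !cnormE -rmorphD lecR. Qed.

Fact cnormZ (z : R[i]) x : cnorm (z *: x) = normc z * cnorm x.
Proof.
by have := normrZ z x; rewrite !cnormE -[`|z|]/((normc z)%:C) -rmorphM => /complexI.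
Qed.

Fact cnormM x y : cnorm (x ** y) <= cnorm x * cnorm y.
Proof. by have := cstar_normM x y; rewrite !cnormE -rmorphM lecR. Qed.

Fact cnorm_cstar_le x : cnorm x ^+ 2 <= cnorm (star x ** x).
Proof. by have := cstar_norm x; rewrite !cnormE -rmorphXn => /complexI ->. Qed.

Definition cstar_norm_seminorm : cstar_seminorm X :=
  CstarSeminorm cnorm_ge0 cnormD cnormZ cnormM cnorm_cstar_le.
Local Notation N := cstar_norm_seminorm.

Lemma cnorm_eq0 x : N x = 0 -> x = 0.
Proof. by move=> x0; apply/eqP; rewrite -normr_eq0 cnormE [cnorm x]x0. Qed.

Lemma cnorm_le_eps x (C : R) : 0 <= C -> (forall d, 0 < d -> N x <= C * d) -> x = 0.
Proof.
move=> C0 h; apply: cnorm_eq0; apply/le_anti; rewrite csn_ge0 andbT.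
apply/ler_addgt0Pr => d d0; rewrite add0r.
have C1 : 0 < C + 1 by lra.
apply: (le_trans (h (d / (C + 1)) (divr_gt0 d0 C1))).
by rewrite mulrA ler_pdivrMr//; nra.
Qed.

(** Convergence by comparison with a bounded monotone real sequence. *)
Lemma dominated_cvg (u : nat -> X) (r : nat -> R) (M : R) :
  (forall m n, (m <= n)%N -> N (u n - u m) <= r n - r m) ->
  (forall n, r n <= M) ->
  exists l, forall d, 0 < d ->
    exists n0, forall n, (n0 <= n)%N -> N (u n - l) <= d.
Proof.
move=> ur rM; pose E := range r.
have Esup : has_sup E.
  split; first by exists (r 0%N), 0%N.
  by exists M => _ [n _ <-].
have cau (d : R) : 0 < d ->
    exists n0, forall n, (n0 <= n)%N -> N (u n - u n0) < d.
  move=> d0; have [_ [n0 _ <-] h] := sup_adherent d0 Esup; exists n0 => n n0n.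
  apply: le_lt_trans (ur _ _ n0n) _; rewrite ltrBlDr -ltrBlDl.
  apply: le_lt_trans h; rewrite lerB// sup_upper_bound//; by exists n.
have : cvg (u @ \oo).
  apply: cauchy_cvg; apply/cauchyP => /= d d0.
  have dE : d = (complex.Re d)%:C by rewrite RRe_real// gtr0_real.
  rewrite dE ltcR in d0; have [n0 h] := cau _ d0.
  exists (u n0); exists n0 => // n /h.
  by rewrite -ball_normE /= distrC dE cnormE ltcR.
move=> /cvg_ex[l /cvgrPdist_lt ul]; exists l => d d0.
have [|n0 _ h] := ul d%:C; first by rewrite ltcR.
exists n0 => n /h; rewrite /= distrC cnormE ltcR; exact: ltW.
Qed.

Section Sqrt.
Variable e : X.
Hypothesis e1 : is_identity e.
Variable g : X.
Hypotheses (sg : self_adjoint g) (g1 : N g <= 1).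

Let half : R := 2^-1.
Let half0 : 0 < half. Proof. by rewrite invr_gt0. Qed.
Let half2 : half + half = 1. Proof. rewrite /half; lra. Qed.

Fixpoint sqrt_iter n : X :=
  if n is m.+1 then half%:C *: (g + sqrt_iter m ** sqrt_iter m) else 0.
(** The iteration run on the numbers with [g] replaced by 1.  It increases to 1
    and dominates [sqrt_iter] together with its increments; this works up to
    [N g = 1], where the convergence is not geometric. *)
Fixpoint sqrt_iterR n : R :=
  if n is m.+1 then half * (1 + sqrt_iterR m ^+ 2) else 0.
Local Notation y := sqrt_iter.
Local Notation r := sqrt_iterR.

Let r_bnd n : 0 <= r n <= 1.
Proof.
elim: n => [|n] /=; first by rewrite lexx ler01.
case/andP=> r0 r1; rewrite /half; apply/andP; split; nra.
Qed.

Let y_le n : N (y n) <= r n.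
Proof.
elim: n => [|n IH]; first by rewrite csn0.
rewrite [y _]/= csnZR gtr0_norm// ler_pM2l// (le_trans (csnD _ _ _))//.
rewrite lerD// (le_trans (csnM _ _ _))// -expr2 ler_pXn2r ?nnegrE ?csn_ge0//.
by case/andP: (r_bnd n).
Qed.

Let y_step n : N (y n.+1 - y n) <= r n.+1 - r n.
Proof.
elim: n => [|n IH].
  by rewrite !subr0; apply: y_le.
have -> : y n.+2 - y n.+1 =
    half%:C *: (y n.+1 ** (y n.+1 - y n) + (y n.+1 - y n) ** y n).
  rewrite [y n.+2]/= [in X in _ - X]/= -scalerBr; congr (_ *: _).
  rewrite !smulrBr !smulrBl; rewrite -/(y n.+1); lmod_eq.
have -> : r n.+2 - r n.+1 =
    half * (r n.+1 * (r n.+1 - r n) + (r n.+1 - r n) * r n).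
  have rS m : r m.+1 = half * (1 + r m ^+ 2) by [].
  by rewrite (rS n.+1) {2}(rS n); ring.
rewrite csnZR gtr0_norm// ler_pM2l// (le_trans (csnD _ _ _))//.
by rewrite lerD// (le_trans (csnM _ _ _))// ler_pM ?csn_ge0 ?y_le.
Qed.

Let y_cauchy m n : (m <= n)%N -> N (y n - y m) <= r n - r m.
Proof.
elim: n => [|n IH]; rewrite leq_eqVlt => /predU1P[->|]; rewrite ?subrr ?csn0//.
rewrite ltnS => /IH h; rewrite -(subrK (y n) (y n.+1)) -addrA.
rewrite (le_trans (csnD _ _ _))//; have := y_step n; lra.
Qed.

(** The root is [s = e - l], where [l] is the limit of the iteration, so that
    [2 l = g + l^2].  Each property of [l] passes to the limit from the
    iterates. *)
Lemma cstar_sqrt : exists s, [/\ self_adjoint s, s ** s = e - g,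
  N (e - s) <= 1 & forall c, c ** g = g ** c -> c ** s = s ** c].
Proof.
have [|l ul] := @dominated_cvg y r 1 y_cauchy.
  by move=> n; case/andP: (r_bnd n).
have approx (d : R) : 0 < d -> exists n, N (y n - l) <= d /\ N (y n.+1 - l) <= d.
  by move=> /ul[n h]; exists n; split; apply: h.
have y1 n : N (y n) <= 1 by apply: le_trans (y_le n) _; case/andP: (r_bnd n).
have l1 : N l <= 1.
  apply/ler_addgt0Pr => d /approx[n [h _]].
  rewrite -(subKr (y n) l) (le_trans (csnB _ _ _))// lerD//.
have sl : self_adjoint l.
  apply/eqP; rewrite -subr_eq0; apply/eqP.
  apply: (@cnorm_le_eps _ 2) => // d /approx[n [h _]].
  have sy : star (y n) = y n.
    elim: n {h} => [|n IH]; first exact: star0.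
    by rewrite /= starZR starD sg starM IH.
  have -> : star l - l = (y n - l) - star (y n - l) by rewrite starB sy; lmod_eq.
  by rewrite (le_trans (csnB _ _ _))// csn_star; lra.
have cl c : c ** g = g ** c -> c ** l = l ** c.
  move=> cg; apply/eqP; rewrite -subr_eq0; apply/eqP.
  apply: (@cnorm_le_eps _ (2 * N c)) => [|d /approx[n [h _]]].
    by rewrite mulr_ge0 ?csn_ge0.
  have cy : c ** y n = y n ** c.
    elim: n {h} => [|n IH]; first by rewrite /= smulr0 smul0r.
    by rewrite /= smulZr smulZl smulDr smulDl cg smulA IH -smulA IH smulA.
  have -> : c ** l - l ** c = (y n - l) ** c - c ** (y n - l).
    rewrite smulrBr smulrBl cy; lmod_eq.
  rewrite (le_trans (csnB _ _ _))// (le_trans (lerD (csnM _ _ _) (csnM _ _ _)))//.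
  have := csn_ge0 N c; nra.
have ll : l *+ 2 = g + l ** l.
  apply/eqP; rewrite -subr_eq0; apply/eqP.
  apply: (@cnorm_le_eps _ 4) => // d /approx[n [h h']].
  have y2 : y n.+1 *+ 2 = g + y n ** y n.
    by rewrite /= scalerMnl -rmorphMn mulr2n half2 scale1r.
  have -> : l *+ 2 - (g + l ** l) =
    (y n ** (y n - l) + (y n - l) ** l) - (y n.+1 - l) *+ 2.
    rewrite mulrnBl y2 smulrBr smulrBl; lmod_eq.
  rewrite (le_trans (csnB _ _ _))// csnMn (le_trans (lerD (csnD _ _ _) (lexx _)))//.
  rewrite (le_trans (lerD (lerD (csnM _ _ _) (csnM _ _ _)) (lexx _)))//.
  have := y1 n; have := csn_ge0 N l; have := csn_ge0 N (y n).
  have := csn_ge0 N (y n - l); nra.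
exists (e - l); split.
- by rewrite /self_adjoint starB sl (star_identity e1).
- rewrite !smulE !(smul1r e1) !(smulr1 e1).
  have -> : g = l *+ 2 - l ** l by rewrite ll addrK.
  lmod_eq.
- by rewrite subKr.
- by move=> c /cl h; rewrite smulrBr smulrBl (smul1r e1) (smulr1 e1) h.
Qed.

End Sqrt.
End CstarAlgebras.


(** * Positivity of the elements [star a ** a] *)

Section KelleyVaught.
Context {R : realType} {X : cstarAlgType R} (e : X).
Hypothesis e1 : is_identity e.
Implicit Types a b c g h x y : X.
Local Notation N := (cstar_norm_seminorm (X := X)).
Local Notation pos := (csn_pos N e).

(** For the square root [s] of [e - h^2], which commutes with [h], this compares
    [s^2] with [s^2 + h^2 = e]. *)
Lemma cstar_sqr_le1 h : self_adjoint h -> N h <= 1 -> N (e - h ** h) <= 1.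
Proof.
move=> sh h1.
have hh1 : N (h ** h) <= 1.
  by rewrite (le_trans (csnM _ _ _))// mulr_ile1 ?csn_ge0.
have shh : self_adjoint (h ** h) by rewrite /self_adjoint starM sh.
have [s [ss sE _ sC]] := cstar_sqrt e1 shh hh1.
have hs : s ** h = h ** s by rewrite sC// smulA.
have := csn_sqr_le N ss sh hs; rewrite sE subrK => /le_trans; apply.
exact: csn_identity.
Qed.

Lemma cstar_sqr_pos h : self_adjoint h -> pos (h ** h).
Proof.
move=> sh; pose t := N h + 1; have t0 : 0 < t.
  by have := csn_ge0 N h; rewrite /t; lra.
have -> : h ** h = (t ^+ 2)%:C *: ((t^-1%:C *: h) ** (t^-1%:C *: h)).
  rewrite smulZl smulZr !scalerA -!rmorphM.
  have -> : t ^+ 2 * (t^-1 * t^-1) = 1 by field; rewrite gt_eqF.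
  by rewrite scale1r.
apply: csn_posZ; first exact: exprn_gt0.
apply/csn_pos_unit/cstar_sqr_le1; first by rewrite /self_adjoint starZR sh.
rewrite csnZR gtr0_norm ?invr_gt0// mulrC ler_pdivrMr// /t; lra.
Qed.

(** After rescaling, [csn_flip] makes [- c c^*] positive.  As [c^* + c] and
    [i (c^* - c)] are self-adjoint and their squares add up to
    [2 c^* c + 2 c c^*], both [c^* c] and its opposite are positive. *)
Lemma cstar_neg_star_sqr c : pos (- (star c ** c)) -> c = 0.
Proof.
move=> cc; apply: cnorm_eq0.
have cc' : pos (- (c ** star c)).
  have [t t0] := cc; rewrite opprK => ht; exists t; rewrite // opprK.
  pose r := Num.sqrt t; have r0 : 0 < r by rewrite sqrtr_gt0.
  have rr : r * r = t by rewrite -expr2 sqr_sqrtr// ltW.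
  pose d := r^-1%:C *: c.
  have dE a b : (r^-1%:C *: a) ** (r^-1%:C *: b) = t^-1%:C *: (a ** b).
    by rewrite smulZl smulZr scalerA -rmorphM -invfM rr.
  have sd : star d = r^-1%:C *: star c by rewrite starZR.
  have scale a : t%:C *: e + a = t%:C *: (e + t^-1%:C *: a).
    by rewrite scalerDr scalerA -rmorphM divff ?gt_eqF// scale1r.
  move: ht; rewrite !scale !csnZR !gtr0_norm// -[leRHS]mulr1 ler_pM2l//.
  rewrite -!dE -sd => /(csn_flip e1) h.
  by rewrite -[leRHS]mulr1 ler_pM2l.
have sumE : star c ** c *+ 2 = (star c + c) ** (star c + c)
    + ('i *: (c - star c)) ** ('i *: (c - star c)) - c ** star c *+ 2.
  have ii : 'i * 'i = -1 :> R[i] by rewrite -expr2 sqr_i.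
  rewrite smulZl smulZr scalerA ii !smulE; lmod_eq.
have Mn2 a : pos a -> pos (a *+ 2).
  by move=> pa; rewrite mulr2n; apply: csn_posD.
have scc : self_adjoint (star c ** c) by rewrite /self_adjoint starM starK.
have pcc : pos (star c ** c *+ 2).
  rewrite sumE -mulNrn; apply: csn_posD; last exact: Mn2.
  apply: csn_posD; apply: cstar_sqr_pos.
    by rewrite /self_adjoint starD starK addrC.
  rewrite /self_adjoint starZ starB starK -opprB scalerN -scaleNr.
  by congr (_ *: _); apply/eqP; rewrite eq_complex /= ?oppr0 ?opprK !eqxx.
have : N (star c ** c *+ 2) = 0.
  apply: (csn_pos_extreme e1) => //; last by rewrite -mulNrn; apply: Mn2.
  by rewrite /self_adjoint starMn scc.
rewrite csnMn csn_cstar => /eqP; rewrite mulrn_eq0/= sqrf_eq0 => /eqP.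
exact.
Qed.

(** Let [h = a^* a], let [m] be the square root of [h^2] and [n] that of [m].
    The element [q = m - h] is twice the negative part of [h].  Since
    [h q = - m q] and [m = n^2], one gets [(a q)^* (a q) = - (n q)^2] with [n q]
    self-adjoint, so [a q = 0], hence [q = 0] and [h = m]. *)
Lemma cstar_star_sqr_pos a : pos (star a ** a).
Proof.
(* normalized so that e - h^2 has norm at most 1, and h^2 thus a square root *)
wlog a1 : a / N (star a ** a) <= 1 => [hw|].
  pose t := N a + 1; have t0 : 0 < t.
    by have := csn_ge0 N a; rewrite /t; lra.
  have -> : star a ** a =
      (t ^+ 2)%:C *: (star (t^-1%:C *: a) ** (t^-1%:C *: a)).
    rewrite starZR smulZl smulZr !scalerA -!rmorphM.
    have -> : t ^+ 2 * (t^-1 * t^-1) = 1 by field; rewrite gt_eqF.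
    by rewrite scale1r.
  apply: csn_posZ; first exact: exprn_gt0.
  apply: hw; rewrite csn_cstar expr_le1 ?csn_ge0//.
  rewrite csnZR gtr0_norm ?invr_gt0// mulrC ler_pdivrMr// /t; lra.
set h := star a ** a in a1 *.
have sh : self_adjoint h by rewrite /self_adjoint starM starK.
have shh : self_adjoint (e - h ** h).
  by rewrite /self_adjoint starB (star_identity e1) starM sh.
have [m [sm mE m1 mC]] := cstar_sqrt e1 shh (cstar_sqr_le1 sh a1).
rewrite subKr in mE.
have hm : h ** m = m ** h.
  by apply: mC; rewrite smulrBr smulrBl (smul1r e1) (smulr1 e1) smulA.
have sem : self_adjoint (e - m).
  by rewrite /self_adjoint starB (star_identity e1) sm.
have [n [sn nE _ nC]] := cstar_sqrt e1 sem m1; rewrite subKr in nE.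
pose q := m - h.
have sq : self_adjoint q by rewrite /self_adjoint starB sm sh.
have qn : q ** n = n ** q.
  apply: nC; rewrite (smulrBr q e m) (smulrBl q e m) (smul1r e1) (smulr1 e1).
  congr (_ - _).
  by rewrite /q smulrBl smulrBr hm.
have hq : h ** q = - (m ** q).
  by rewrite /q !smulrBr hm mE opprB.
have snq : self_adjoint (n ** q) by rewrite /self_adjoint starM sn sq.
have cc : star (a ** q) ** (a ** q) = - ((n ** q) ** (n ** q)).
  rewrite starM sq -smulA (smulA (star a)) -/h hq smulrN; congr (- _).
  by rewrite -{1}qn -nE !smulA.
have aq : a ** q = 0.
  by apply: cstar_neg_star_sqr; rewrite cc opprK; apply: cstar_sqr_pos.
have nq : n ** q = 0.
  apply: cnorm_eq0; apply/eqP; rewrite -sqrf_eq0 -csn_sa//.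
  by move/eqP: cc; rewrite aq smulr0 eq_sym oppr_eq0 => /eqP ->; rewrite csn0.
have mq : m ** q = 0 by rewrite -nE -smulA nq smulr0.
have q0 : q = 0.
  apply: cnorm_eq0; apply/eqP; rewrite -sqrf_eq0 -csn_sa//.
  by rewrite {1}/q smulrBl mq hq mq oppr0 subrr csn0.
have -> : h = m by apply/eqP; rewrite eq_sym -subr_eq0 -/q q0.
exact: csn_pos_unit.
Qed.

Theorem cstar_sum_star_sqr_eq0 (I : finType) (a : I -> X) :
  \sum_i star (a i) ** a i = 0 -> forall i, a i = 0.
Proof.
move=> suma i; apply: cstar_neg_star_sqr.
move/eqP: suma; rewrite (bigD1 i)//= addr_eq0 => /eqP ->; rewrite opprK.
apply: big_ind => [||j _]; [exact: csn_pos0 | exact: csn_posD |].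
exact: cstar_star_sqr_pos.
Qed.

End KelleyVaught.

(** * Homomorphisms, matrices and representable algebras *)

Section StarHom.
Context {R : realType} {A B : starAlgType R} (f : A -> B).
Hypothesis hf : star_hom f.

Lemma star_homM x y : f (x ** y) = f x ** f y. Proof. by case: hf. Qed.
Lemma star_hom_star x : f (star x) = star (f x). Proof. by case: hf. Qed.

Lemma star_homD x y : f (x + y) = f x + f y.
Proof. by case: hf => fl _ _; rewrite -[x]scale1r fl !scale1r. Qed.

Lemma star_hom0 : f 0 = 0.
Proof. by apply: (addrI (f 0)); rewrite -star_homD !addr0. Qed.

Lemma star_homZ z x : f (z *: x) = z *: f x.
Proof. by case: hf => fl _ _; rewrite -[z *: x]addr0 fl star_hom0 addr0. Qed.

Lemma star_homB x y : f (x - y) = f x - f y.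
Proof. by rewrite -scaleN1r star_homD star_homZ scaleN1r. Qed.

Lemma star_hom_sum (I : finType) (F : I -> A) : f (\sum_i F i) = \sum_i f (F i).
Proof. by apply: (big_morph f) => [x y|]; rewrite ?star_homD ?star_hom0. Qed.

Lemma star_hom_pos_cone x : pos_cone x -> pos_cone (f x).
Proof.
move=> [n [a ->]]; exists n, (f \o a); rewrite star_hom_sum.
by apply: eq_bigr => i _; rewrite star_homM star_hom_star.
Qed.

Lemma star_hom_range : star_subalgebra (range f).
Proof.
split; first split.
- by exists 0; rewrite ?star_hom0.
- by move=> _ _ [x _ <-] [y _ <-]; exists (x + y); rewrite ?star_homD.
- by move=> z _ [x _ <-]; exists (z *: x); rewrite ?star_homZ.
- by move=> _ [x _ <-]; exists (star x); rewrite ?star_hom_star.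
- by move=> _ _ [x _ <-] [y _ <-]; exists (x ** y); rewrite ?star_homM.
Qed.

Section Pullback.
Variable N : cstar_seminorm B.

Let nD x y : N (f (x + y)) <= N (f x) + N (f y).
Proof. by rewrite star_homD csnD. Qed.
Let nZ (z : R[i]) x : N (f (z *: x)) = normc z * N (f x).
Proof. by rewrite star_homZ csnZ. Qed.
Let nM x y : N (f (x ** y)) <= N (f x) * N (f y).
Proof. by rewrite star_homM csnM. Qed.
Let n_cstar_le x : N (f x) ^+ 2 <= N (f (star x ** x)).
Proof. by rewrite star_homM star_hom_star csn_cstar. Qed.

Definition csn_pullback : cstar_seminorm A :=
  CstarSeminorm (fun x => csn_ge0 N (f x)) nD nZ nM n_cstar_le.

End Pullback.
End StarHom.

Definition sum_positive (R : realType) (A : starAlgType R) : Prop :=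
  forall n (a : 'I_n.+1 -> A), \sum_i star (a i) ** a i = 0 -> forall i, a i = 0.

(** For an equation [star x ** x = 0] between matrices the diagonal entries are
    sums of squares over the columns of [x]; conversely a family with vanishing
    sum of squares is repeated in all columns of a matrix. *)
Lemma completely_positiveP (R : realType) (A : starAlgType R) :
  completely_positive A <-> sum_positive A.
Proof.
split=> [cp n a sum0 i|sp [//|n] _ x xx].
  pose x : starmx A n.+1 := \matrix_(i, j) a i.
  suff /matrixP/(_ i i) : x = 0 by rewrite !mxE.
  apply: cp => //; apply/matrixP => j k; rewrite !mxE -[RHS]sum0.
  by apply: eq_bigr => l _; rewrite !mxE.
apply/matrixP => i j; rewrite [RHS]mxE.
apply: (sp n (fun k => x k j)); move/matrixP/(_ j j): xx; rewrite !mxE => xx.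
rewrite -[RHS]xx.
by apply: eq_bigr => k _; rewrite !mxE.
Qed.

Section UnitalCompletion.
Context {R : realType} {A : starAlgType R} (N : cstar_seminorm A) (e : A).
Hypothesis e1 : is_identity e.

Lemma to_completion_identity : is_identity (to_completion N e).
Proof.
apply: (@csn_quotW _ _ (limsup_seminorm N)) => u.
have [_ hM _] := csn_class_star_hom (limsup_seminorm N).
rewrite -[_ ** _]hM -[X in _ /\ X = _]hM; split; congr csn_class;
  by apply: bdd_seqP => n; case: (e1 (u n)).
Qed.

End UnitalCompletion.

(** The given C*-algebra need not have the unit of [A] as its unit; completing
    [A] for the induced norm provides one that does. *)
Lemma representable_completely_positive (R : realType) (A : starAlgType R)
    (e : A) : is_identity e -> Cstar_representable A -> completely_positive A.
Proof.
move=> e1 [X [_ [f [_ hf finj _]]]]; apply/completely_positiveP => n a sum0 i.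
pose N := csn_pullback hf (cstar_norm_seminorm (X := X)).
have hi := to_completion_star_hom N.
have : to_completion N (a i) = 0.
  apply: (cstar_sum_star_sqr_eq0 (to_completion_identity (N := N) e1)
    (a := fun i => to_completion N (a i))).
  rewrite -[RHS](star_hom0 hi) -sum0 (star_hom_sum hi).
  by apply: eq_bigr => j _; rewrite (star_homM hi) (star_hom_star hi).
move/(congr1 Num.norm); rewrite norm_to_completion normr0 => /complexI /= fa0.
by apply: finj; rewrite (star_hom0 hf); apply: cnorm_eq0.
Qed.

(** * The order seminorm of a bounded algebra *)

Section PosCone.
Context {R : realType} {A : starAlgType R}.
Implicit Types a b x y : A.

Lemma pos_cone_star_sqr a : pos_cone (star a ** a).
Proof. by exists 0%N, (fun=> a); rewrite big_ord1. Qed.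

Lemma pos_coneD x y : pos_cone x -> pos_cone y -> pos_cone (x + y).
Proof.
move=> [n [a ->]] [m [b ->]]; exists (n + m.+1)%N.
exists (fun i : 'I_(n.+1 + m.+1) =>
  match fintype.split i with inl j => a j | inr j => b j end).
rewrite (@big_split_ord _ _ _ n.+1 m.+1) /=; congr (_ + _); apply: eq_bigr => i _.
  by rewrite -[lshift _ _]/(unsplit (inl i)) unsplitK.
by rewrite -[rshift _ _]/(unsplit (inr i)) unsplitK.
Qed.

Lemma pos_coneZ (r : R) x : 0 <= r -> pos_cone x -> pos_cone (r%:C *: x).
Proof.
move=> r0 [n [a ->]]; exists n, (fun i => (Num.sqrt r)%:C *: a i).
rewrite scaler_sumr; apply: eq_bigr => i _.
by rewrite starZR smulZl smulZr scalerA -rmorphM -expr2 sqr_sqrtr.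
Qed.

Lemma pos_coneZK (r : R) x : 0 < r -> pos_cone (r%:C *: x) -> pos_cone x.
Proof.
move=> r0 /(pos_coneZ (ltW (_ : 0 < r^-1))); rewrite invr_gt0 => /(_ r0).
by rewrite scalerA -rmorphM mulVf ?gt_eqF// scale1r.
Qed.

Lemma pos_cone_conj x b : pos_cone x -> pos_cone (star b ** x ** b).
Proof.
move=> [n [a ->]]; exists n, (fun i => a i ** b).
rewrite smul_sumr smul_suml; apply: eq_bigr => i _.
by rewrite starM !smulA.
Qed.

End PosCone.

Section OrderNorm.
Context {R : realType} {A : starAlgType R} (e : A).
Hypothesis e1 : is_identity e.
Implicit Types (a b h x y : A) (s t : R).

(** The order-theoretic form of [N x <= t]. *)
Definition ole_norm t x : Prop := pos_cone ((t ^+ 2)%:C *: e - star x ** x).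

Lemma pos_cone_identity : pos_cone e.
Proof.
by rewrite -(smul1r e1 e) -{1}(star_identity e1); apply: pos_cone_star_sqr.
Qed.

Lemma ole_norm_le s t x : 0 <= s -> s <= t -> ole_norm s x -> ole_norm t x.
Proof.
move=> s0 st sx; rewrite /ole_norm.
have -> : (t ^+ 2)%:C *: e - star x ** x =
    (t ^+ 2 - s ^+ 2)%:C *: e + ((s ^+ 2)%:C *: e - star x ** x).
  rewrite rmorphB scalerBl; lmod_eq.
apply: pos_coneD => //; apply: pos_coneZ pos_cone_identity.
by rewrite subr_ge0 ler_pXn2r ?nnegrE// (le_trans s0).
Qed.

(** After multiplication by [s t], the defect of the sum is a positive
    combination of the two given defects and of the square of [t x - s y]. *)
Lemma ole_normD s t x y : 0 < s -> 0 < t -> ole_norm s x -> ole_norm t y ->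
  ole_norm (s + t) (x + y).
Proof.
move=> s0 t0 sx ty; rewrite /ole_norm; apply: (pos_coneZK (mulr_gt0 s0 t0)).
pose w := t%:C *: x - s%:C *: y.
have -> : (s * t)%:C *: (((s + t) ^+ 2)%:C *: e - star (x + y) ** (x + y)) =
    ((s + t) * t)%:C *: ((s ^+ 2)%:C *: e - star x ** x) +
    ((s + t) * s)%:C *: ((t ^+ 2)%:C *: e - star y ** y) + star w ** w.
  rewrite /w starB !starZR starD !smulE; lmod_eq.
have st0 : 0 <= s + t by rewrite addr_ge0 ?ltW.
apply: pos_coneD (pos_cone_star_sqr w); apply: pos_coneD;
  by apply: pos_coneZ => //; rewrite mulr_ge0// ltW.
Qed.

Lemma ole_normZ t (z : R[i]) x : ole_norm t x -> ole_norm (normc z * t) (z *: x).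
Proof.
move=> tx; have zz : z^* * z = (normc z ^+ 2)%:C.
  by rewrite rmorphXn mulrC -sqr_normc.
rewrite /ole_norm.
have -> : ((normc z * t) ^+ 2)%:C *: e - star (z *: x) ** (z *: x) =
    (normc z ^+ 2)%:C *: ((t ^+ 2)%:C *: e - star x ** x).
  rewrite starZ smulZl smulZr !scalerA zz exprMn; lmod_eq.
by apply: pos_coneZ; rewrite ?sqr_ge0.
Qed.

Lemma ole_normM s t x y : ole_norm s x -> ole_norm t y -> ole_norm (s * t) (x ** y).
Proof.
move=> sx ty; rewrite /ole_norm.
have -> : ((s * t) ^+ 2)%:C *: e - star (x ** y) ** (x ** y) =
    (s ^+ 2)%:C *: ((t ^+ 2)%:C *: e - star y ** y) +
    star y ** ((s ^+ 2)%:C *: e - star x ** x) ** y.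
  rewrite starM !smulE (smulr1 e1) !smulA exprMn; lmod_eq.
by apply: pos_coneD; [apply: pos_coneZ; rewrite ?sqr_ge0 | apply: pos_cone_conj].
Qed.

(** For [h = star x ** x] one has
    [2 t (t e - h) = (t e - h)^2 + (t^2 e - h^2)]; this yields the C*-inequality
    of the order seminorm. *)
Lemma ole_norm_sqrt t x : 0 < t -> ole_norm t (star x ** x) ->
  ole_norm (Num.sqrt t) x.
Proof.
move=> t0; rewrite /ole_norm sqr_sqrtr ?(ltW t0)//; set h := star x ** x => th.
have sh : star h = h by rewrite starM starK.
apply: (@pos_coneZK _ _ (2 * t)); first by rewrite mulr_gt0.
have -> : (2 * t)%:C *: (t%:C *: e - h) =
    star (t%:C *: e - h) ** (t%:C *: e - h) + ((t ^+ 2)%:C *: e - star h ** h).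
  rewrite starB starZR (star_identity e1) sh !smulE !(smul1r e1) !(smulr1 e1).
  lmod_eq.
by apply: pos_coneD th; apply: pos_cone_star_sqr.
Qed.

(** The defect [t^2 e - h^2], multiplied by [2 t], is the sum of the two elements
    [(t e + h) (t e - h) (t e + h)] and [(t e - h) (t e + h) (t e - h)]. *)
Lemma ole_norm_sa t h : self_adjoint h -> 0 < t ->
  pos_cone (t%:C *: e - h) -> pos_cone (t%:C *: e + h) -> ole_norm t h.
Proof.
move=> sh t0 hm hp; rewrite /ole_norm.
apply: (@pos_coneZK _ _ (2 * t)); first by rewrite mulr_gt0.
have sp : star (t%:C *: e + h) = t%:C *: e + h.
  by rewrite starD starZR (star_identity e1) sh.
have sm : star (t%:C *: e - h) = t%:C *: e - h.
  by rewrite starB starZR (star_identity e1) sh.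
have -> : (2 * t)%:C *: ((t ^+ 2)%:C *: e - star h ** h) =
    star (t%:C *: e + h) ** (t%:C *: e - h) ** (t%:C *: e + h) +
    star (t%:C *: e - h) ** (t%:C *: e + h) ** (t%:C *: e - h).
  rewrite sp sm sh !smulE !(smul1r e1) !(smulr1 e1); lmod_eq.
by apply: pos_coneD; apply: pos_cone_conj.
Qed.

(** The bound is strictly positive so that [ole_normD] applies. *)
Lemma elt_bounded_ole_norm x : elt_bounded e x -> exists2 t, 0 < t & ole_norm t x.
Proof.
have sab a : self_adjoint a -> sa_bounded e a -> exists2 t, 0 < t & ole_norm t a.
  move=> sa [t t0 [hm hp]]; exists (t + 1); first by rewrite ltr_wpDl.
  apply: ole_norm_sa => //; first by rewrite ltr_wpDl.
    have -> : (t + 1)%:C *: e - a = e + (t%:C *: e - a).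
      rewrite rmorphD scalerDl scale1r; lmod_eq.
    exact: pos_coneD pos_cone_identity hm.
  have -> : (t + 1)%:C *: e + a = e + (a - (- t%:C) *: e).
    rewrite rmorphD scalerDl scale1r; lmod_eq.
  exact: pos_coneD pos_cone_identity hp.
move=> [a [b [sa sb -> /(sab _ sa)[s s0 sN] /(sab _ sb)[t t0 tN]]]].
exists (s + t); first exact: addr_gt0.
apply: ole_normD => //.
have <- : normc 'i * t = t by rewrite /= expr0n expr1n add0r sqrtr1 mul1r.
exact: ole_normZ.
Qed.

Section Seminorm.
Hypothesis bounded : forall x, exists2 t, 0 < t & ole_norm t x.

Definition order_norm x : R := inf [set t | 0 < t /\ ole_norm t x].

Let order_has_inf x : has_inf [set t | 0 < t /\ ole_norm t x].
Proof.
split; first by have [t t0 tx] := bounded x; exists t.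
by exists 0 => t [/ltW].
Qed.

Lemma order_norm_le t x : 0 < t -> ole_norm t x -> order_norm x <= t.
Proof. by move=> t0 tx; apply: ge_inf => //; case: (order_has_inf x). Qed.

Fact order_norm_ge0 x : 0 <= order_norm x.
Proof.
by apply: lb_le_inf => [|t [/ltW]//]; case: (order_has_inf x).
Qed.

Lemma order_norm_lt t x : order_norm x < t -> ole_norm t x.
Proof.
move=> xt; have [s [s0 sx]] : exists2 s, 0 < s /\ ole_norm s x & s < t.
  have := inf_adherent (_ : 0 < t - order_norm x) (order_has_inf x).
  by rewrite subr_gt0 addrC subrK => /(_ xt).
by move=> st; apply: (ole_norm_le (ltW s0) (ltW st)).
Qed.

Let above x d : 0 < d -> 0 < order_norm x + d /\ ole_norm (order_norm x + d) x.
Proof.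
move=> d0; split; first by rewrite ltr_wpDl ?order_norm_ge0.
by apply: order_norm_lt; rewrite ltrDl.
Qed.

Fact order_normD x y : order_norm (x + y) <= order_norm x + order_norm y.
Proof.
apply/ler_addgt0Pr => d d0; have d2 : 0 < d / 2 by rewrite divr_gt0.
have [s0 sx] := above x d2; have [t0 ty] := above y d2.
have := order_norm_le (addr_gt0 s0 t0) (ole_normD s0 t0 sx ty); lra.
Qed.

Let order_normZ_le z x : z != 0 -> order_norm (z *: x) <= normc z * order_norm x.
Proof.
move=> z0; have nz := normc_gt0 z0.
apply/ler_addgt0Pr => d d0.
have [t0 tx] := above x (divr_gt0 d0 nz).
apply: (le_trans (order_norm_le (mulr_gt0 nz t0) (ole_normZ z tx))).
by rewrite mulrDr mulrC mulrCA divff ?gt_eqF// mulr1 mulrC.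
Qed.

Fact order_normZ z x : order_norm (z *: x) = normc z * order_norm x.
Proof.
have [->|z0] := eqVneq z 0.
  rewrite normc0 mul0r scale0r; apply/le_anti; rewrite order_norm_ge0 andbT.
  apply/ler_addgt0Pr => d d0; rewrite add0r; apply: order_norm_le => //.
  rewrite /ole_norm smulr0 subr0; apply: pos_coneZ pos_cone_identity.
  exact: sqr_ge0.
apply/le_anti; rewrite order_normZ_le//=.
have nz := normc_gt0 z0.
rewrite -ler_pdivlMl// -normcV.
have := @order_normZ_le z^-1 (z *: x).
by rewrite scalerA mulVf// scale1r invr_eq0; apply.
Qed.

Fact order_normM x y : order_norm (x ** y) <= order_norm x * order_norm y.
Proof.
apply: ler_mul_limit => [||s t sx ty]; rewrite ?order_norm_ge0//.
have s0 := le_lt_trans (order_norm_ge0 x) sx.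
have t0 := le_lt_trans (order_norm_ge0 y) ty.
apply: order_norm_le (mulr_gt0 s0 t0) (ole_normM _ _); exact: order_norm_lt.
Qed.

Fact order_norm_cstar_le x : order_norm x ^+ 2 <= order_norm (star x ** x).
Proof.
apply/ler_addgt0Pr => d d0; have [t0 tx] := above (star x ** x) d0.
rewrite -[leRHS]sqr_sqrtr ?(ltW t0)// ler_pXn2r ?nnegrE ?sqrtr_ge0 ?order_norm_ge0//.
by apply: order_norm_le (ole_norm_sqrt t0 tx); rewrite sqrtr_gt0.
Qed.

Definition order_seminorm : cstar_seminorm A :=
  CstarSeminorm order_norm_ge0 order_normD order_normZ order_normM
    order_norm_cstar_le.

End Seminorm.
End OrderNorm.

Section OrderNormHom.
Context {R : realType} {A B : starAlgType R} (e : A) (e' : B) (f : A -> B).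
Hypotheses (e1 : is_identity e) (e1' : is_identity e') (hf : star_hom f).

(** The image [g] of the unit is a projection, so [e' - g] is a square and the
    homomorphism, although possibly not unital, respects the bounds. *)
Lemma ole_norm_hom t x : ole_norm e t x -> ole_norm e' t (f x).
Proof.
move=> tx; rewrite /ole_norm; pose g := f e.
have gg : star (e' - g) ** (e' - g) = e' - g.
  have gs : star g = g by rewrite -(star_hom_star hf) (star_identity e1).
  have g2 : g ** g = g by rewrite -(star_homM hf) (smul1r e1).
  rewrite starB gs (star_identity e1') !smulE g2 !(smul1r e1') (smulr1 e1').
  lmod_eq.
have -> : (t ^+ 2)%:C *: e' - star (f x) ** f x =
    (t ^+ 2)%:C *: (star (e' - g) ** (e' - g)) +
    f ((t ^+ 2)%:C *: e - star x ** x).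
  rewrite gg (star_homB hf) (star_homZ hf) (star_homM hf) (star_hom_star hf).
  rewrite -/g; lmod_eq.
apply: pos_coneD (star_hom_pos_cone hf tx).
by apply: pos_coneZ (pos_cone_star_sqr _); apply: sqr_ge0.
Qed.

Variables (bA : forall x, exists2 t, 0 < t & ole_norm e t x)
          (bB : forall x, exists2 t, 0 < t & ole_norm e' t x).

Lemma order_norm_hom x : order_norm e' (f x) <= order_norm e x.
Proof.
apply/ler_addgt0Pr => d d0; apply: (order_norm_le bB).
  by rewrite ltr_wpDl// (order_norm_ge0 bA).
by apply/ole_norm_hom/(order_norm_lt e1 bA); rewrite ltrDl.
Qed.

End OrderNormHom.

(** * Endomorphically simple algebras and direct sums *)

Section EndoSimple.
Context {R : realType} {B : starAlgType R} (e : B).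
Hypotheses (e1 : is_identity e)
  (bounded : forall x, exists2 t, 0 < t & ole_norm e t x).

(** The kernel of the order seminorm is an endomorphically closed star ideal.
    If it contains the unit, then [e / 4 - e] is a sum of squares [a_j^* a_j],
    and the squares of the [2 a_j] and of [sqrt 3 e] add up to zero. *)
Lemma endo_simple_order_norm_eq0 x :
  endo_simple B -> sum_positive B -> order_norm e x = 0 -> x = 0.
Proof.
pose N := order_seminorm e1 bounded; pose J : set B := [set x | N x = 0].
move=> simple sp x0.
have J_ideal : star_ideal J.
  split=> [|a y y0]; first split=> [|y z y0 z0|c y y0|y y0].
  - exact: (csn0 N).
  - by apply: (csn_eq0 (N := N)); rewrite (le_trans (csnD N _ _))// y0 z0 addr0.
  - by apply: etrans (csnZ N c y) _; rewrite [N y]y0 mulr0.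
  - by apply: etrans (csn_star N y) _.
  - by split; apply: (csn_eq0 (N := N)); rewrite (le_trans (csnM N _ _))//
      y0 ?mul0r ?mulr0.
have J_endo : endo_closed J.
  move=> f hf _ [y y0 <-]; apply: (csn_eq0 (N := N)); rewrite -y0.
  exact: (order_norm_hom e1 e1 hf bounded bounded).
have [J0|JT] := simple J J_ideal J_endo.
  by have : J x by []; rewrite J0.
have : J e by rewrite JT.
rewrite /J /= => e0.
suff ee : e = 0 by rewrite -(smul1r e1 x) ee smul0r.
have : ole_norm e (2^-1) e.
  by apply: (order_norm_lt e1 bounded); rewrite [order_norm e e]e0 invr_gt0.
rewrite /ole_norm (star_identity e1) (smul1r e1) => -[n [a aE]].
(* the sum of the a_j^* a_j is - (3/4) e *)
pose b (i : 'I_n.+2) :=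
  if unlift ord0 i is Some j then 2%:C *: a j else (Num.sqrt 3)%:C *: e.
suff : b ord0 = 0.
  rewrite /b unlift_none => /eqP; rewrite scaler_eq0 => /orP[|/eqP//].
  by rewrite (inj_eq (@complexI R) _ 0) gt_eqF// sqrtr_gt0.
apply: sp; rewrite big_ord_recl /b unlift_none.
under eq_bigr => j _ do rewrite liftK starZR smulZl smulZr scalerA -rmorphM.
rewrite -scaler_sumr -aE starZR (star_identity e1) smulZl smulZr (smul1r e1).
rewrite !scalerA -rmorphM -expr2 sqr_sqrtr// scalerBr scalerA -rmorphM.
have -> : 2 * 2 * 2^-1 ^+ 2 = 1 :> R by field.
rewrite scale1r.
have -> : 2 * 2 = 3 + 1 :> R by ring.
rewrite rmorphD scalerDl scale1r; lmod_eq.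
Qed.

End EndoSimple.

(** Elements of a summand lift to elements supported on that summand. *)
Lemma direct_sum_lift (R : realType) (A : starAlgType R) (I : Type)
    (B : I -> starAlgType R) (p : forall n, A -> B n) :
  (forall b : (forall n, B n), finite_set [set n | b n != 0] ->
    exists a, forall n, p n a = b n) ->
  forall n (b : B n), exists a, p n a = b /\ forall m, m <> n -> p m a = 0.
Proof.
move=> surj n b.
pose c m : B m := if pselect (n = m) is left nm then eq_rect n B b m nm else 0.
have [|a pa] := surj c.
  apply: (@sub_finite_set _ _ [set n]); last exact: finite_set1.
  by move=> m /=; rewrite /c; case: pselect => // _; rewrite eqxx.
exists a; split=> [|m mn]; rewrite pa /c; case: pselect => // nn.
  by rewrite (Prop_irrelevance nn erefl).
by case: mn.
Qed.

Lemma completely_positive_representable (R : realType) (A : starAlgType R)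
    (e : A) (I : Type) (B : I -> starAlgType R) :
  is_identity e -> bounded_alg e -> is_direct_sum A B ->
  (forall n, endo_simple (B n)) ->
  completely_positive A -> Cstar_representable A.
Proof.
move=> e1 he [p [ph pinj _ psurj]] simple /completely_positiveP sp.
have lift := direct_sum_lift psurj.
have bA x := elt_bounded_ole_norm e1 (he x).
have en1 n : is_identity (p n e).
  move=> b; have [a [<- _]] := lift n b.
  by rewrite -!(star_homM (ph n)); case: (e1 a) => -> ->.
have bB n (b : B n) : exists2 t, 0 < t & ole_norm (p n e) t b.
  have [a [<- _]] := lift n b; have [t t0 ta] := bA a; exists t => //.
  exact: (ole_norm_hom e1 (en1 n) (ph n)).
have spB n : sum_positive (B n).
  move=> k b sum0 i; have [a ab] := choice (fun i => lift n (b i)).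
  suff -> : b i = p n (a i).
    rewrite (sp k a) ?(star_hom0 (ph n))//; apply: pinj => m.
    rewrite (star_hom_sum (ph m)) (star_hom0 (ph m)).
    have [mn|mn] := pselect (m = n); last first.
      apply: big1 => j _; have [_ /(_ m mn) am] := ab j.
      by rewrite (star_homM (ph m)) am smulr0.
    subst m; rewrite -[RHS]sum0; apply: eq_bigr => j _; have [<- _] := ab j.
    by rewrite (star_homM (ph n)) (star_hom_star (ph n)).
  by have [] := ab i.
pose N := order_seminorm e1 bA.
have N0 x : N x = 0 -> x = 0.
  move=> x0; apply: pinj => n; rewrite (star_hom0 (ph n)).
  apply: (endo_simple_order_norm_eq0 (en1 n) (@bB n) (simple n) (spB n)).
  apply/le_anti; rewrite (order_norm_ge0 (@bB n)) andbT -x0.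
  exact: (order_norm_hom e1 (en1 n) (ph n) bA (@bB n)).
have hi := to_completion_star_hom N.
exists (completion N : cstarAlgType R), (range (to_completion N)).
exists (to_completion N).
split=> //; first exact: star_hom_range.
move=> x y xy; apply/eqP; rewrite -subr_eq0; apply/eqP/N0/complexI.
by rewrite -norm_to_completion (star_homB hi) xy subrr normr0.
Qed.

Theorem corollary4 (R : realType) (A : starAlgType R) (e : A)
    (he : is_identity e) (hbounded : bounded_alg e)
    (I : Type) (B : I -> starAlgType R)
    (hsum : is_direct_sum A B) (hsimple : forall n : I, endo_simple (B n)) :
  Cstar_representable A <-> completely_positive A.
Proof.
split; first exact: representable_completely_positive he.
exact: completely_positive_representable he hbounded hsum hsimple.
Qed.
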